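(* Let $G$ be a Dedekind $\sigma$-complete $\ell$-group and let $M=\Gamma(\mathbb Z\,\overrightarrow{\times}\,G,(1,0))$ be the corresponding perfect MV-algebra. If $F:\mathbb R^2\to M$ is a two-dimensional spectral resolution on $M$, then there is a unique two-dimensional observable $x$ on $M$ such that $x((-\infty,s)\times(-\infty,t))=F(s,t)$ for each $(s,t)\in\mathbb R^2$.
   Context: All groups are Abelian and written additively. An $\ell$-group $G$ is Dedekind $\sigma$-complete if every nonempty countable subset of $G$ bounded above has a supremum in $G$. $\mathbb Z\,\overrightarrow{\times}\,G$ is the group $\mathbb Z\times G$ with lexicographic order: $(m,g)\le(m',g')$ iff $m<m'$, or $m=m'$ and $g\le g'$. $\Gamma(\mathbb Z\,\overrightarrow{\times}\,G,(1,0))$ is the interval $[(0,0),(1,0)]$ with its usual MV-algebra structure ($a\oplus b=(a+b)\wedge(1,0)$, $a'=(1,0)-a$); its bottom is $0=(0,0)$ and its top is $1=(1,0)$. The partial addition $a+b$ on $M$ is the group sum, defined when the group sum is $\le(1,0)$. $\mathrm{Rad}(M)=\{(0,g):g\in G,\ g\ge 0\}$ and $\mathrm{Rad}(M)'=\{(1,-g): g\in G,\ g\ge0\}$; $M$ is their disjoint union. Suprema and infima below are taken in $M$. A two-dimensional spectral resolution on $M$ is a map $F:\mathbb R^2\to M$ such that: (i) (volume condition) for all reals $a_1\le b_1$, $a_2\le b_2$, $F(b_1,b_2)-F(a_1,b_2)-F(b_1,a_2)+F(a_1,a_2)\ge0$, computed in $\mathbb Z\,\overrightarrow{\times}\,G$;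 (ii) $\bigvee_{s_1<t_1,\,s_2<t_2}F(s_1,s_2)=F(t_1,t_2)$ for all $(t_1,t_2)\in\mathbb R^2$; (iii) $\bigwedge_{t\in\mathbb R}F(t,s)=0=\bigwedge_{t\in\mathbb R}F(s,t)$ for all $s\in\mathbb R$; (iv) $\bigvee_{(s_1,s_2)\in\mathbb R^2}F(s_1,s_2)=1$; (v) if $(s_0,t_0)$ denotes the characteristic point of $F$, i.e. the coordinatewise infimum of $T_1=\{(s,t)\in\mathbb R^2: F(s,t)\in\mathrm{Rad}(M)'\}$, then $\bigwedge\{F(s,t): s>s_0,\ t>t_0\}$ exists in $M$ and belongs to $\mathrm{Rad}(M)'$. A two-dimensional observable on $M$ is a map $x:\mathcal B(\mathbb R^2)\to M$ on the Borel $\sigma$-algebra such that $x(\mathbb R^2)=1$; $x(A\cup B)=x(A)+x(B)$ (the sum being defined in $M$) for disjoint Borel sets $A,B$; and $x(\bigcup_iA_i)=\bigvee_i x(A_i)$ for every non-decreasing sequence $(A_i)_i$ of Borel sets. *)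

(* Defs.v *)
From HB Require Import structures.
From mathcomp Require Import all_boot all_order all_algebra.
From mathcomp Require Import all_classical all_reals all_analysis.

Set Implicit Arguments.
Unset Strict Implicit.
Unset Printing Implicit Defensive.

Import Order.TTheory GRing.Theory Num.Theory.
Import numFieldNormedType.Exports.

Local Open Scope classical_set_scope.
Local Open Scope ring_scope.

(* In the library a [porderZmodType] is a group with an unrelated partial
   order; compatibility and the lattice property are required here. *)
Record is_lgroup (G : porderZmodType) : Prop := IsLGroup {
  lgroup_leD2r : forall z x y : G, x <= y -> x + z <= y + z ;
  lgroup_join : forall x y : G, exists s, supremums [set x; y] s ;
  lgroup_meet : forall x y : G, exists i, infimums [set x; y] i
}.

Definition dedekind_sigma_complete (G : porderZmodType) : Prop :=
  forall A : set G, A !=set0 -> countable A -> has_ubound A ->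
    exists s, supremums A s.

(* [int *lexi[_] G] is the library's lexicographic order, but it carries no
   group law; the addition is the componentwise one of [int * G]. *)
Definition zlex (G : porderZmodType) : Type := int *lexi[ring_display] G.

HB.instance Definition _ (G : porderZmodType) :=
  Order.POrder.copy (zlex G) (int *lexi[ring_display] G).
HB.instance Definition _ (G : porderZmodType) :=
  GRing.Zmodule.copy (zlex G) (int * G)%type.

Record gamma (H : porderZmodType) (u : H) :=
  Gamma { gval : H ; gvalP : 0 <= gval <= u }.

HB.instance Definition _ H u := [isSub for @gval H u].
HB.instance Definition _ H u := [Choice of @gamma H u by <:].
HB.instance Definition _ H u :=
  [SubChoice_isSubPOrder of @gamma H u by <: with ring_display].

(* The partial addition: [gpadd a b = Some c] iff [gval a + gval b] lies in the
   interval [0, u] and equals [gval c]. *)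
Definition gpadd H u (a b : @gamma H u) : option (gamma u) :=
  insub (gval a + gval b).

Section PerfectMV.
Variable G : porderZmodType.

Definition zlex1 : zlex G := (1, 0).

Definition perfect_mv := gamma zlex1.

Fact perfect_mv0_subproof : 0 <= (0 : zlex G) <= zlex1.
Proof. by rewrite lexx. Qed.

Fact perfect_mv1_subproof : 0 <= zlex1 <= zlex1.
Proof. by rewrite lexx. Qed.

Definition mv0 : perfect_mv := Gamma perfect_mv0_subproof.
Definition mv1 : perfect_mv := Gamma perfect_mv1_subproof.

(* $\mathrm{Rad}(M)'$, the set of complements [(1, 0) - a] of the elements
   [a = (0, g)], [0 <= g], of the radical. *)
Definition mv_corad : set perfect_mv :=
  [set a : perfect_mv | exists2 g : G, 0 <= g & gval a = (1, - g)].

End PerfectMV.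

Arguments mv0 {G}.
Arguments mv1 {G}.
Arguments mv_corad {G}.

Section TwoDimensional.
Variables (R : realType) (G : porderZmodType).
Notation M := (perfect_mv G).

Definition borel2 : set (set (R * R)) := <<s [set A : set (R * R) | open A] >>.

Definition characteristic_point (F : R * R -> M) (p : R * R) : Prop :=
  let T1 := [set q | mv_corad (F q)] in
  infimums (fst @` T1) p.1 /\ infimums (snd @` T1) p.2.

Record spectral_resolution2 (F : R * R -> M) : Prop := SpectralResolution2 {
  sr2_volume : forall a1 b1 a2 b2 : R, a1 <= b1 -> a2 <= b2 ->
    0 <= gval (F (b1, b2)) - gval (F (a1, b2)) - gval (F (b1, a2))
         + gval (F (a1, a2)) ;
  sr2_left_continuous : forall t1 t2 : R,
    supremums [set F s | s in [set s : R * R | s.1 < t1 /\ s.2 < t2]]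
              (F (t1, t2)) ;
  sr2_inf_fst : forall s : R, infimums (range (fun t => F (t, s))) mv0 ;
  sr2_inf_snd : forall s : R, infimums (range (fun t => F (s, t))) mv0 ;
  sr2_sup : supremums (range F) mv1 ;
  sr2_characteristic_point : exists2 p : R * R, characteristic_point F p &
    exists2 m : M,
      infimums [set F q | q in [set q : R * R | p.1 < q.1 /\ p.2 < q.2]] m &
      mv_corad m
}.

(* Only the values of [x] on Borel sets are meaningful, as for the measures of
   the library, which are also total functions on [set T]. *)
Record observable2 (x : set (R * R) -> M) : Prop := Observable2 {
  obs2_setT : x setT = mv1 ;
  obs2_add : forall A B : set (R * R), borel2 A -> borel2 B ->
    A `&` B = set0 -> gpadd (x A) (x B) = Some (x (A `|` B)) ;
  obs2_sup : forall A : nat -> set (R * R), (forall i, borel2 (A i)) ->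
    (forall i, A i `<=` A i.+1) ->
    supremums (range (fun i => x (A i))) (x (\bigcup_i A i))
}.

End TwoDimensional.

(* Main.v *)
(** The integer part of [F] is a two-dimensional distribution function with
    values in [{0, 1}], namely that of the Dirac mass at the characteristic
    point [p]. By condition (v), adding a large constant [c] of [G] on the open
    quadrant above [p] turns the [G]-part of [F] into a [G]-valued distribution
    function [h] with total mass [c]; if [nu] is the [G]-valued measure
    associated with [h], the observable is
    [x A = (1_A p, nu A - c * 1_A p)].

    To extend [h] to a measure, use real-valued "generic states" of [G]: from a
    decreasing sequence of elements [0 < u <= c] (a forcing chain) meeting
    countably many prescribed dense sets, one reads off a state of [G], additive
    on given elements and preserving countably many given suprema
    (Rasiowa-Sikorski), and there are enough such states to separate points.
    Generically, the composite of [h] with the state is a real distribution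
    function on the rational plane, so it has a Stieltjes measure [P]. The
    Borel sets [A] for which generically [P A] is the value of the state at one
    fixed element [nu A] of [G] form a lambda-system, hence are all Borel sets.
    No weak distributivity of [G] is needed, because this works pointwise on
    states instead of approximating Borel sets within [G]. *)

From HB Require Import structures.
Require Import Defs.
From mathcomp Require Import all_boot all_order all_algebra finmap.
From mathcomp Require Import all_classical all_reals all_analysis.
From mathcomp Require Import ring lra.

Set Implicit Arguments.
Unset Strict Implicit.
Unset Printing Implicit Defensive.

Import Order.TTheory GRing.Theory Num.Theory.
Import numFieldNormedType.Exports.

Local Open Scope classical_set_scope.
Local Open Scope ring_scope.

(** * Lattice-ordered groups *)

Section LatticeOrderedGroups.
Variables (G : porderZmodType) (hG : is_lgroup G).
Implicit Types x y z t u v : G.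

Lemma lg_leD2 x y z t : x <= y -> z <= t -> x + z <= y + t.
Proof.
move=> xy zt; apply: (le_trans (lgroup_leD2r hG z xy)).
by rewrite ![y + _]addrC; exact: lgroup_leD2r.
Qed.

Lemma lg_subr_ge0 x y : (0 <= y - x) = (x <= y).
Proof.
apply/idP/idP => [/(lgroup_leD2r hG x)|/(lgroup_leD2r hG (- x))].
  by rewrite add0r subrK.
by rewrite subrr.
Qed.

Lemma lg_subr_le0 x y : (y - x <= 0) = (y <= x).
Proof.
apply/idP/idP => [/(lgroup_leD2r hG x)|/(lgroup_leD2r hG (- x))].
  by rewrite add0r subrK.
by rewrite subrr.
Qed.

Lemma lg_ge0B x y : x <= y -> 0 <= y - x.
Proof. by rewrite lg_subr_ge0. Qed.

Lemma lg_leN2 x y : x <= y -> - y <= - x.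
Proof. by rewrite -(lg_subr_ge0 x y) -(lg_subr_ge0 (- y)) opprK addrC. Qed.

Lemma lg_leN2E x y : (- y <= - x) = (x <= y).
Proof.
by apply/idP/idP => [/lg_leN2|/lg_leN2//]; rewrite !opprK.
Qed.

Lemma lg_oppr_le0 x : (- x <= 0) = (0 <= x).
Proof. by rewrite -{1}oppr0 lg_leN2E. Qed.

Lemma lg_oppr_ge0 x : (0 <= - x) = (x <= 0).
Proof. by rewrite -{1}oppr0 lg_leN2E. Qed.

Lemma lg_leBlDr x y z : (x - y <= z) = (x <= z + y).
Proof. by rewrite -[LHS]lg_subr_le0 -[RHS]lg_subr_le0 opprD addrA addrAC. Qed.

Lemma lg_leBrDr x y z : (x <= y - z) = (x + z <= y).
Proof. by rewrite -[LHS]lg_subr_ge0 -[RHS]lg_subr_ge0 opprD addrA addrAC. Qed.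

Lemma lg_addr_ge0 x y : 0 <= x -> 0 <= y -> 0 <= x + y.
Proof. by move=> x0 y0; rewrite -[0]addr0; exact: lg_leD2. Qed.

Lemma lg_mulrn_ge0 x n : 0 <= x -> 0 <= x *+ n.
Proof.
move=> x0; elim: n => [|n IH]; first by rewrite mulr0n.
by rewrite mulrS; exact: lg_addr_ge0.
Qed.

Lemma lg_lerMn2r x y n : x <= y -> x *+ n <= y *+ n.
Proof.
move=> xy; rewrite -lg_subr_ge0 -mulrnBl.
by apply: lg_mulrn_ge0; rewrite lg_subr_ge0.
Qed.

(** [is_lgroup] only asserts that joins exist, so one is picked by choice; the default 0 is never
    reached. *)
Definition lgjoin x y := xget 0 (supremums [set x; y]).
Definition lgmeet x y := - lgjoin (- x) (- y).

Lemma lgjoinP x y : supremums [set x; y] (lgjoin x y).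
Proof. by have [s hs] := lgroup_join hG x y; exact: (xgetI _ hs). Qed.

Lemma le_lgjoinl x y : x <= lgjoin x y.
Proof. by have [+ _] := lgjoinP x y; apply; left. Qed.

Lemma le_lgjoinr x y : y <= lgjoin x y.
Proof. by have [+ _] := lgjoinP x y; apply; right. Qed.

Lemma lgjoin_le x y z : x <= z -> y <= z -> lgjoin x y <= z.
Proof. by move=> xz yz; have [_] := lgjoinP x y; apply => t [->|->]. Qed.

Lemma lgmeet_lel x y : lgmeet x y <= x.
Proof. by rewrite -lg_leN2E opprK le_lgjoinl. Qed.

Lemma lgmeet_ler x y : lgmeet x y <= y.
Proof. by rewrite -lg_leN2E opprK le_lgjoinr. Qed.

Lemma le_lgmeet x y z : z <= x -> z <= y -> z <= lgmeet x y.
Proof.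
by move=> zx zy; rewrite -lg_leN2E opprK lgjoin_le// lg_leN2E.
Qed.

(** The negative part of [x]; [lgneg (- x)] is its positive part. *)
Definition lgneg x := lgjoin (- x) 0.

Lemma lgneg_ge0 x : 0 <= lgneg x. Proof. exact: le_lgjoinr. Qed.

Lemma lgneg_geN x : - x <= lgneg x. Proof. exact: le_lgjoinl. Qed.


(** Positive and negative parts are disjoint: since [lgneg (- x) <= x + lgneg x], an element [z]
    below both makes [lgneg x - z] an upper bound of [- x] and [0], hence of [lgneg x]. *)
Lemma lgneg_perp x z : z <= lgneg x -> z <= lgneg (- x) -> z <= 0.
Proof.
have le : lgneg (- x) <= x + lgneg x.
  rewrite lgjoin_le// ?opprK.
    by rewrite -{1}(addr0 x) lg_leD2// lgneg_ge0.
  by rewrite -(subrr x) lg_leD2// lgneg_geN.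
move=> zn /le_trans/(_ le) zp.
have : lgneg x <= lgneg x - z.
  rewrite {1}/lgneg lgjoin_le// ?lg_subr_ge0//.
  by rewrite lg_leBrDr addrC lg_leBlDr addrC.
by move/lg_ge0B; rewrite addrAC subrr add0r lg_oppr_ge0.
Qed.

Lemma lgneg_homo x y : x <= y -> lgneg y <= lgneg x.
Proof.
move=> xy; rewrite lgjoin_le ?lgneg_ge0//.
by rewrite (le_trans _ (lgneg_geN x))// lg_leN2E.
Qed.

Lemma lgnegD x y : lgneg (x + y) <= lgneg x + lgneg y.
Proof.
rewrite lgjoin_le//; last by rewrite lg_addr_ge0 ?lgneg_ge0.
by rewrite opprD lg_leD2 ?lgneg_geN.
Qed.

Definition perp u v := forall z, z <= u -> z <= v -> z <= 0.

(** If [z] is below [u] and [v + t], then [z - t] is below [u] and [v]; so [z <= t], and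
    disjointness from [t] concludes. *)
Lemma perpD u v t : 0 <= t -> perp u v -> perp u t -> perp u (v + t).
Proof.
move=> t0 uv ut z zu zvt; apply: ut => //.
rewrite -lg_subr_le0; apply: uv; last by rewrite lg_leBlDr.
by rewrite lg_leBlDr (le_trans zu)// -{1}(addr0 u) lg_leD2.
Qed.

(* In a representation of [G] by functions, [u] forces [x] to be nonnegative
   iff [x >= 0] on the support of [u]. *)
Definition forces u x := perp u (lgneg x).

Lemma forcesD u x y : forces u x -> forces u y -> forces u (x + y).
Proof.
move=> ux uy z zu zxy; apply: (perpD (lgneg_ge0 y) ux uy) => //.
exact: le_trans (lgnegD x y).
Qed.

Lemma forces_le u v x y : v <= u -> x <= y -> forces u x -> forces v y.
Proof.
move=> vu xy ux z zv zy; apply: ux; first exact: le_trans vu.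
exact: (le_trans zy (lgneg_homo xy)).
Qed.

Lemma forces_ge0 u x : 0 <= x -> forces u x.
Proof.
move=> x0 z _ /le_trans; apply.
by rewrite lgjoin_le// lg_oppr_le0.
Qed.

Lemma forcesMn u x n : forces u x -> forces u (x *+ n).
Proof.
move=> ux; elim: n => [|n IH]; first by rewrite mulr0n; exact: forces_ge0.
by rewrite mulrS; exact: forcesD.
Qed.

(** The candidate is the meet of [u] and [lgneg x]. If it vanishes, [u] is disjoint from [lgneg x];
    otherwise it lies below [lgneg x], hence is disjoint from [lgneg (- x)]. *)
Lemma forces_decide u x : 0 < u ->
  forces u x \/ exists v, [/\ 0 < v, v <= u & forces v (- x)].
Proof.
move=> u0; have [e|e] := eqVneq (lgmeet u (lgneg x)) 0.
  by left => z zu zx; rewrite -e le_lgmeet.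
right; exists (lgmeet u (lgneg x)); split; last 2 first.
- exact: lgmeet_lel.
- by move=> z zv; exact: lgneg_perp (le_trans zv (lgmeet_ler _ _)).
- by rewrite lt_def e le_lgmeet ?lgneg_ge0// ltW.
Qed.

Lemma forcesN_not u x : 0 < u -> u <= x -> ~ forces u (- x).
Proof.
move=> u0 ux /(_ u (lexx _)) h; have := lt_geF u0; rewrite h//.
by apply: (le_trans ux); rewrite -{1}(opprK x) lgneg_geN.
Qed.

(** Monotonicity decouples the indices: [u <= d i + d j *+ n] for all [i] and [j]. The induction
    hypothesis over [j] gives [u <= d i], and then [i] varies. *)
Lemma nonincreasing_inf_mulrn (d : nat -> G) u n : {homo d : i j / (i <= j)%N >-> j <= i} ->
  (forall x, (forall j, x <= d j) -> x <= 0) ->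
  (forall j, u <= d j *+ n) -> u <= 0.
Proof.
move=> dd d0; elim: n u => [|n IH] u ud; first by have := ud 0; rewrite mulr0n.
apply: d0 => i; rewrite -lg_subr_le0; apply: IH => j.
rewrite lg_leBlDr (le_trans (ud (maxn i j)))// mulrS addrC lg_leD2//.
  by apply: lg_lerMn2r; apply: dd; rewrite leq_maxr.
by apply: dd; rewrite leq_maxl.
Qed.

(** If [s] is the supremum of the multiples of [x], then [s - x] is an upper bound of them too. *)
Lemma lg_archimedean x y : dedekind_sigma_complete G ->
  (forall n, x *+ n <= y) -> x <= 0.
Proof.
move=> hGc xy.
have [||| s [sub slub]] := hGc (range (fun n => x *+ n)).
- by exists (x *+ 0), 0.
- by apply: sub_countable (card_image_le _ _) _; exact: countableP.
- by exists y => _ [n _ <-].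
have : s <= s - x.
  by apply: slub => _ [n _ <-]; rewrite lg_leBrDr -mulrSr; apply: sub; exists n.+1.
by move/lg_ge0B; rewrite addrAC subrr add0r lg_oppr_ge0.
Qed.

End LatticeOrderedGroups.

(** * Generic states *)

Section GenericStates.
Variables (R : realType) (G : porderZmodType).
Hypotheses (hG : is_lgroup G) (hGc : dedekind_sigma_complete G).
Variable c : G.
Hypothesis c_ge0 : 0 <= c.
Implicit Types (x y z u v : G) (w : nat -> G) (P Q : (nat -> G) -> Prop).

Definition condition u := 0 < u <= c.

Definition dense_condition (D : set G) :=
  forall u, condition u -> exists v, [/\ condition v, v <= u & D v].

Definition condition_chain w :=
  (forall n, condition (w n)) /\ (forall n, w n.+1 <= w n).

(* [P] holds for every chain meeting countably many suitable dense sets; such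
   properties play the role of comeager sets, and [generic_ex] that of the
   Baire category theorem. *)
Definition generic P := exists D : nat -> set G,
  (forall n, dense_condition (D n)) /\
  (forall w, condition_chain w -> (forall n, exists k, D n (w k)) -> P w).

Lemma generic_dense D : dense_condition D -> generic (fun w => exists k, D (w k)).
Proof. by move=> hD; exists (fun _ => D); split => // w _ /(_ 0). Qed.

Lemma generic_imp P Q : (forall w, condition_chain w -> P w -> Q w) ->
  generic P -> generic Q.
Proof.
by move=> PQ [D [dD DP]]; exists D; split => // w cw /(DP w cw); exact: PQ.
Qed.

Lemma generic_forall (I : countType) (P : I -> (nat -> G) -> Prop) :
  (forall i, generic (P i)) -> generic (fun w => forall i, P i w).
Proof.
move=> /(_ _)/cid-/all_sig[D /all_and2[dD DP]].
(* Codes of pairs [(i, j)] list the dense sets of all the [P i] in one sequence; numbers that code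
   nothing get the trivially dense [setT]. *)
exists (fun m : nat => if choice.unpickle m : option (I * nat)%type is Some (i, j)
                 then D i j else setT); split => [m u cu|w cw Dw i].
  by case: choice.unpickle => [[i j]|]; [exact: dD|exists u].
apply: DP => // j.
by have := Dw (choice.pickle (i, j)); rewrite choice.pickleK.
Qed.

Lemma generic_and P Q : generic P -> generic Q -> generic (fun w => P w /\ Q w).
Proof.
move=> hP hQ.
have := @generic_forall bool (fun b w => if b then P w else Q w).
move=> /(_ _)/(generic_imp _); apply; last by case.
by move=> w _ h; split; [exact: (h true)|exact: (h false)].
Qed.

Lemma generic_imp2 P1 P2 Q :
  (forall w, condition_chain w -> P1 w -> P2 w -> Q w) ->
  generic P1 -> generic P2 -> generic Q.
Proof.
move=> PQ h1 h2; apply: generic_imp (generic_and h1 h2) => w cw [].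
exact: PQ.
Qed.

(** Dependent choice: step [n.+1] goes below step [n] and into [D n]. The prescribed start [u]
    allows a chain to begin with a condition that already forces something. *)
Lemma generic_ex P u : condition u -> generic P ->
  exists w, [/\ condition_chain w, w 0 = u & P w].
Proof.
move=> cu [D [dD DP]].
have next n (v : {v | condition v}) :
    {v' : {v | condition v} | sval v' <= sval v /\ D n (sval v')}.
  by apply: cid; case: v => v cv; have [v' [cv' ? ?]] := dD n v cv; exists (exist _ v' cv').
pose s := fix s n := if n is n'.+1 then sval (next n' (s n'))
                     else exist condition u cu.
exists (fun n => sval (s n)); split => //.
  split => n; first exact: (svalP (s n)).
  by have [] := svalP (next n (s n)).
apply: DP => [|n].
  split => n; first exact: (svalP (s n)).
  by have [] := svalP (next n (s n)).
by exists n.+1; have [] := svalP (next n (s n)).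
Qed.

Lemma condition_chain_homo w : condition_chain w ->
  {homo w : i j / (i <= j)%N >-> j <= i}.
Proof.
move=> [_ wS] i j /subnK <-; elim: (j - i)%N => // k IH.
by rewrite addSn (le_trans (wS _)).
Qed.

Lemma forces_chain w x y k l : condition_chain w ->
  forces (w k) x -> forces (w l) y -> exists j, forces (w j) x /\ forces (w j) y.
Proof.
move=> cw wx wy; exists (maxn k l); split.
  by apply: (forces_le hG _ (lexx x) wx); apply: condition_chain_homo => //; exact: leq_maxl.
by apply: (forces_le hG _ (lexx y) wy); apply: condition_chain_homo => //; exact: leq_maxr.
Qed.

(** The convex subgroup generated by [c], on which values measured in units of [c] are finite. *)
Definition bounded_by_unit x := exists N, - (c *+ N) <= x <= c *+ N.

Lemma bounded_by_unit_itv x : 0 <= x <= c -> bounded_by_unit x.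
Proof.
move=> /andP[x0 xc]; exists 1; rewrite mulr1n xc andbT.
by rewrite (le_trans _ x0)// lg_oppr_le0.
Qed.

Lemma bounded_by_unitN x : bounded_by_unit x -> bounded_by_unit (- x).
Proof.
by case=> N /andP[h1 h2]; exists N; rewrite lg_leN2E// h2 -(opprK (c *+ N)) lg_leN2E.
Qed.

Lemma bounded_by_unitD x y :
  bounded_by_unit x -> bounded_by_unit y -> bounded_by_unit (x + y).
Proof.
case=> N /andP[h1 h2] [M /andP[h3 h4]]; exists (N + M)%N.
by rewrite mulrnDr opprD !lg_leD2.
Qed.

(** A lower Dedekind cut with unit [c]: [m / n.+1] belongs to it once some member of the chain
    forces [x *+ n.+1] to dominate [c *~ m]. *)
Definition lower_values w x : set R := [set r | exists m n k,
  r = m%:~R / n.+1%:R /\ forces (w k) (x *+ n.+1 - c *~ m)].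

Definition state w x : R := sup (lower_values w x).

Lemma unit_mulrz_ge (m : int) : 0 < m -> c <= c *~ m.
Proof.
case: m => [[|m]|m] //= _; rewrite -pmulrn mulrS.
by rewrite -{1}(addr0 c) lg_leD2// lg_mulrn_ge0.
Qed.

(** If [m / n.+1] exceeded [N], then [w k] would lie below the positive multiple [m - N * n.+1] of
    [c] while forcing its opposite, against [forcesN_not]. *)
Lemma lower_values_le w x N r : condition_chain w -> x <= c *+ N ->
  lower_values w x r -> r <= N%:R.
Proof.
move=> cw xN [m [n [k [-> wk]]]].
rewrite ler_pdivrMr ?ltr0n// -natrM -[(_ * _)%:R]/((_ * _)%N%:~R) ler_int leNgt.
apply/negP => ltm; have /andP[w0 wc] := cw.1 k.
apply: (forcesN_not hG w0); last first.
  apply: (forces_le hG (lexx _) _ wk).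
  apply: (@le_trans _ _ (c *+ N *+ n.+1 - c *~ m)).
    by apply: lg_leD2 => //; exact: lg_lerMn2r.
  rewrite -mulrnA pmulrn -mulrzBr -opprB mulrNz; exact: lexx.
by apply: (le_trans wc); apply: unit_mulrz_ge; rewrite subr_gt0.
Qed.

Lemma lower_values_lb w x N : condition_chain w -> - (c *+ N) <= x ->
  lower_values w x (- N%:R).
Proof.
move=> cw xN; exists (- N%:Z), 0, 0; split; first by rewrite mulrNz divr1.
apply: forces_ge0 => //.
by rewrite mulr1n mulrNz opprK -pmulrn -(addNr (c *+ N)) lg_leD2.
Qed.

Lemma lower_values_has_sup w x : condition_chain w -> bounded_by_unit x ->
  has_sup (lower_values w x).
Proof.
move=> cw [N /andP[h1 h2]]; split.
  by exists (- N%:R); exact: lower_values_lb.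
by exists N%:R => r; exact: lower_values_le.
Qed.

Lemma state_ge w x m n k : condition_chain w -> bounded_by_unit x ->
  forces (w k) (x *+ n.+1 - c *~ m) -> m%:~R / n.+1%:R <= state w x.
Proof.
move=> cw bx wk; apply: ub_le_sup; first by case: (lower_values_has_sup cw bx).
by exists m, n, k.
Qed.

Lemma state_le w x N : condition_chain w -> bounded_by_unit x -> x <= c *+ N ->
  state w x <= N%:R.
Proof.
move=> cw bx xN; apply: ge_sup; first by case: (lower_values_has_sup cw bx).
by move=> r; exact: lower_values_le.
Qed.

Lemma state_ge0 w x : condition_chain w -> bounded_by_unit x -> 0 <= x ->
  0 <= state w x.
Proof.
move=> cw bx x0; rewrite -(mul0r 1%:R^-1) -[0]/(0%:~R).
apply: (@state_ge w x 0 0 0) => //.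
by rewrite mulr0z subr0; exact: forces_ge0.
Qed.

(** Two lower values are both forced at the later of their stages, where they can be added over a
    common denominator. *)
Lemma state_superD w x y : condition_chain w ->
  bounded_by_unit x -> bounded_by_unit y -> state w x + state w y <= state w (x + y).
Proof.
move=> cw bx by_; have bxy := bounded_by_unitD bx by_.
have hx := lower_values_has_sup cw bx; have hy := lower_values_has_sup cw by_.
rewrite -lerBrDr; apply: ge_sup; first exact: hx.1.
move=> _ [m [n [k [-> wx]]]]; rewrite lerBrDr addrC -lerBrDr.
apply: ge_sup; first exact: hy.1.
move=> _ [m' [n' [k' [-> wy]]]]; rewrite lerBrDr.
have [j [wjx wjy]] := forces_chain cw wx wy.
have := forcesD hG (forcesMn hG (n:=n'.+1) wjx) (forcesMn hG (n:=n.+1) wjy).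
rewrite !mulrnBl -!mulrnA [(n'.+1 * _)%N]mulnC addrACA -mulrnDl -opprD.
(* Denominators of lower values are written [n.+1], hence the predecessor of the product. *)
rewrite !pmulrn -!mulrzA -mulrzDr => /(state_ge (n := (n.+1 * n'.+1).-1) cw bxy).
rewrite prednK ?muln_gt0//; apply: le_trans.
rewrite rmorphD/= !rmorphM/= natrM -![_%:Z%:~R]/(_%:R).
have : (n.+1%:R : R) != 0 by rewrite pnatr_eq0.
have : (n'.+1%:R : R) != 0 by rewrite pnatr_eq0.
move: (_.+1%:R : R) (_.+1%:R : R) => a b a0 b0.
by rewrite le_eqVlt; apply/orP; left; apply/eqP; field; rewrite a0.
Qed.

Lemma state_unit w : condition_chain w -> state w c = 1.
Proof.
move=> cw; have bc : bounded_by_unit c by apply: bounded_by_unit_itv; rewrite c_ge0 lexx.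
apply/eqP; rewrite eq_le (state_le (N := 1)) ?mulr1n//=.
rewrite -[leLHS](@divr1 R) -[X in X / _]/(1%:~R) -[X in _ / X]/(1%:R).
apply: (@state_ge w c 1 0 0) => //.
by rewrite mulr1n mulr1z subrr; exact: forces_ge0.
Qed.

Lemma state0 w : condition_chain w -> state w 0 = 0.
Proof.
move=> cw; have b0 : bounded_by_unit 0 by apply: bounded_by_unit_itv; rewrite c_ge0 lexx.
apply/eqP; rewrite eq_le state_ge0// andbT.
by apply: (state_le (N := 0)); rewrite ?mulr0n.
Qed.

Lemma le_state w x y : condition_chain w ->
  bounded_by_unit x -> bounded_by_unit y -> x <= y -> state w x <= state w y.
Proof.
move=> cw bx by_ xy; rewrite -(subrK x y).
have byx : bounded_by_unit (y - x).
  by apply: bounded_by_unitD => //; exact: bounded_by_unitN.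
apply: le_trans (state_superD cw byx bx).
by rewrite lerDr state_ge0// lg_ge0B.
Qed.

Lemma dense_decide x :
  dense_condition (fun u => forces u x \/ forces u (- x)).
Proof.
move=> u /[dup] cu /andP[u0 uc]; have [ux|[v [v0 vu vx]]] := forces_decide hG x u0.
  by exists u; split => //; left.
exists v; split => //; last by right.
by rewrite /condition v0 (le_trans vu).
Qed.

(** Superadditivity gives [state w (- x) <= - state w x]. A rational [q] strictly between
    [state w x] and [- state w (- x)] is impossible once the chain decides the sign of every
    [x *+ n.+1 - c *~ m]: it would make [q] a lower value of [x] or [- q] one of [- x]. *)
Lemma generic_stateN x : bounded_by_unit x ->
  generic (fun w => state w (- x) = - state w x).
Proof.
move=> bx; have bNx := bounded_by_unitN bx.
apply: (@generic_imp (fun w => forall mn : int * nat,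
    exists k, forces (w k) (x *+ mn.2.+1 - c *~ mn.1) \/
              forces (w k) (- (x *+ mn.2.+1 - c *~ mn.1)))); last first.
  apply: generic_forall => mn.
  exact: generic_dense (@dense_decide (x *+ mn.2.+1 - c *~ mn.1)).
move=> w cw dec; apply/eqP; rewrite eq_le; apply/andP; split.
  have := state_superD cw bNx bx; rewrite addNr state0//.
  by rewrite -lerBrDr sub0r.
rewrite leNgt; apply/negP => lt0.
have /rat_in_itvoo[q] : state w x < - state w (- x) by rewrite ltrNr.
rewrite in_itv/= => /andP[xq qx].
have [n nE] : exists n, denq q = n.+1%:Z.
  by exists `|denq q|%N.-1; rewrite prednK ?absz_gt0 ?denq_neq0// absz_denq.
have qE : ratr q = (numq q)%:~R / n.+1%:R :> R by rewrite /ratr nE.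
have [k [wk|wk]] := dec (numq q, n).
  by have := state_ge cw bx wk; rewrite -qE leNgt xq.
move: wk; rewrite /= opprB addrC -mulNrn -[X in _ + X]opprK -mulrNz.
move=> /(state_ge cw bNx); rewrite mulrNz mulNr -qE leNgt.
by rewrite ltrNr qx.
Qed.


(** The missing inequality is superadditivity for [(x + y) + (- x)], combined with
    [generic_stateN]. *)
Lemma generic_stateD x y : bounded_by_unit x -> bounded_by_unit y ->
  generic (fun w => state w (x + y) = state w x + state w y).
Proof.
move=> bx by_; have bxy := bounded_by_unitD bx by_.
apply: generic_imp2 (generic_stateN bx) (generic_stateN bxy) => w cw ex exy.
apply/eqP; rewrite eq_le state_superD// andbT.
have := state_superD cw bxy (bounded_by_unitN bx).
by rewrite addrAC subrr add0r ex lerBlDl.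
Qed.

Lemma generic_stateB x y : bounded_by_unit x -> bounded_by_unit y ->
  generic (fun w => state w (x - y) = state w x - state w y).
Proof.
move=> bx by_; have bNy := bounded_by_unitN by_.
apply: generic_imp2 (generic_stateD bx bNy) (generic_stateN by_) => w cw -> ->.
by [].
Qed.

(* Density: if no [v <= u] forces [n (g j - s) + c >= 0] for any [j], then
   [u <= n (s - g j)] for all [j], against [s = sup g]. *)
Lemma generic_state_sup (g : nat -> G) s :
  {homo g : i j / (i <= j)%N >-> i <= j} -> supremums (range g) s ->
  bounded_by_unit s -> (forall j, bounded_by_unit (g j)) ->
  generic (fun w => forall e, 0 < e -> exists j, state w s - e <= state w (g j)).
Proof.
move=> gnd [gub glub] bs bg.
pose D n := [set u | exists j, forces u ((g j - s) *+ n.+1 + c)].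
have dD n : dense_condition (D n).
  move=> u /[dup] cu /andP[u0 uc]; apply: contrapT => no.
  suff : u <= 0 by rewrite lt_geF.
  have fN j : forces u (- ((g j - s) *+ n.+1 + c)).
    have [|[v [v0 vu]]] := forces_decide hG (- ((g j - s) *+ n.+1 + c)) u0 => //.
    rewrite opprK => vf; case: no; exists v; split => //; last by exists j.
    by rewrite /condition v0 (le_trans vu).
  apply: (@nonincreasing_inf_mulrn _ hG (fun j => s - g j) _ n.+1) => [i j ij|x xs|j].
  - by apply: lg_leD2 => //; apply: lg_leN2 => //; exact: gnd.
  - rewrite -(addrK s x) lg_subr_le0// addrC -lg_leBrDr//.
    apply: glub => _ [j _ <-]; rewrite lg_leBrDr// addrC -lg_leBrDr//.
  - rewrite -(lg_subr_le0 hG); apply: (fN j).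
      by rewrite lg_leBlDr// -{1}(addr0 u) lg_leD2// lg_mulrn_ge0// lg_ge0B// gub//; exists j.
    rewrite lg_leBlDr// (le_trans uc)//.
    apply: (@le_trans _ _ ((g j - s) *+ n.+1 + c + (s - g j) *+ n.+1)).
      by rewrite addrAC -mulrnDl -(opprB s) addNr mul0rn add0r.
    by rewrite lg_leD2// -{1}(opprK (_ + c)) lgneg_geN.
apply: (@generic_imp (fun w => forall n, exists k, D n (w k))); last first.
  by apply: generic_forall => n; exact: generic_dense (dD n).
move=> w cw Dw e e0.
have [n ne] : exists n, n.+1%:R^-1 < e.
  by have [n] := ltr_add_invr e0; rewrite add0r; exists n.
have [k [j wk]] := Dw n; exists j.
have bgs : bounded_by_unit (g j - s) by apply: bounded_by_unitD => //; exact: bounded_by_unitN.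
have := @state_ge w (g j - s) (- 1) n k cw bgs.
rewrite mulrNz opprK mulr1z => /(_ wk) h.
have := state_superD cw bgs bs; rewrite subrK; apply: le_trans.
rewrite addrC lerD2r (le_trans _ h)//.
by rewrite mulrNz mulNr mul1r lerN2 ltW.
Qed.

(** Generic states separate points. It suffices that each [z], the excess of [(x - y) *+ n.+1] over
    [c], is at most 0. If [c] forces [- z], the positive part of [z] is disjoint from all multiples
    of [c], one of which bounds it, so it vanishes. Otherwise some [v] forces [z], and a generic
    chain started at [v] gives [x - y] a value of at least [1 / n.+1]. *)
Lemma generic_state_le x y : bounded_by_unit x -> bounded_by_unit y ->
  generic (fun w => state w x <= state w y) -> x <= y.
Proof.
move=> bx by_ gle; rewrite -(lg_subr_le0 hG).
have bxy : bounded_by_unit (x - y) by apply: bounded_by_unitD => //; exact: bounded_by_unitN.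
apply: (lg_archimedean hG (y := c) hGc) => n.
case: n => [|n]; first by rewrite mulr0n.
have [N /andP[_ xyN]] := bxy.
(* For [c = 0] there are no conditions at all, and boundedness alone gives the estimate. *)
have [c_eq0|c_neq0] := eqVneq c 0.
  by apply: (le_trans (lg_lerMn2r hG n.+1 xyN)); rewrite c_eq0 !mul0rn.
have c0 : 0 < c by rewrite lt_def c_neq0.
pose z := (x - y) *+ n.+1 - c.
have zM : lgneg (- z) <= c *+ (N * n.+1).
  rewrite lgjoin_le ?opprK// ?lg_mulrn_ge0// lg_leBlDr// mulrnA.
  by rewrite -[leLHS]addr0 lg_leD2// lg_lerMn2r.
rewrite -lg_subr_le0// -/z.
have [cz|[v [v0 vc]]] := forces_decide hG (- z) c0.
  apply: (@le_trans _ _ (lgneg (- z))); first by rewrite -{1}(opprK z) lgneg_geN.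
  suff /(_ _ (lexx _)) : perp (lgneg (- z)) (c *+ (N * n.+1)) by exact.
  elim: (N * n.+1)%N => [|k IH]; first by move=> t _; rewrite mulr0n.
  by rewrite mulrS; apply: perpD; rewrite ?lg_mulrn_ge0// => t tz tc; exact: cz.
rewrite opprK => vz; have cv : condition v by rewrite /condition v0.
have [w [cw w0 [wle wB]]] := generic_ex cv (generic_and gle (generic_stateB bx by_)).
have := @state_ge w (x - y) 1 n 0 cw bxy.
rewrite mulr1z w0 => /(_ vz); rewrite wB leNgt (le_lt_trans (y := 0))// ?subr_le0//.
Qed.

End GenericStates.

(** * Rational rectangles in the plane *)

Lemma zip_path_lt (x : rat) (s : seq rat) p : path <%R x s ->
  p \in zip (x :: s) s -> x <= p.1 < p.2.
Proof.
elim: s x => [|y s IH] x //= /andP[xy ys]; rewrite inE => /predU1P[->/=|].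
  by rewrite lexx.
by move=> /(IH _ ys)/andP[yp ->]; rewrite (le_trans (ltW xy) yp).
Qed.

Section Telescoping.
Variables (V : zmodType) (K : rat -> V).

(** [zip (x :: s) s] lists the cells of the subdivision, and the boolean multiple acts as an
    indicator. *)
Lemma telescope_lt (x : rat) (s : seq rat) (b : rat) :
  path <%R x s -> b \in x :: s ->
  \sum_(p <- zip (x :: s) s) (K p.2 - K p.1) *+ (p.1 < b)%R = K b - K x.
Proof.
elim: s x => [|y s IH] x /=.
  by move=> _; rewrite inE big_nil => /eqP ->; rewrite subrr.
move=> /andP[xy ys]; rewrite inE => /predU1P[->|bys].
  rewrite big_cons/= ltxx mulr0n add0r subrr big1_seq// => p /andP[_].
  move=> /(zip_path_lt ys)/andP[yp _].
  by rewrite ltNge (le_trans (ltW xy) yp).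
rewrite big_cons /= IH//.
have -> : x < b.
  have xys : path <%R x (y :: s) by rewrite /= xy.
  by have /allP/(_ _ bys) := order_path_min lt_trans xys.
by rewrite mulr1n addrC addrA subrK.
Qed.

Lemma telescope_itv (x : rat) (s : seq rat) (a b : rat) : path <%R x s -> a \in x :: s -> b \in x :: s ->
  a <= b ->
  \sum_(p <- zip (x :: s) s) (K p.2 - K p.1) *+ (a <= p.1 < b)%R = K b - K a.
Proof.
move=> xs ax bx ab; apply: (@addrI _ (K a - K x)).
rewrite [RHS]addrC addrA subrK.
rewrite -(telescope_lt xs bx) -(telescope_lt xs ax) -big_split/=.
apply: eq_bigr => p _; rewrite -mulrnDr; congr (_ *+ _).
have [pa|ap]/= := ltP p.1 a; first by rewrite (lt_le_trans pa ab).
by rewrite add0n.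
Qed.

End Telescoping.

Section RationalRectangles.
Variable R : realType.
Implicit Types a b : rat * rat.

Definition in_rect a b (p : R * R) : bool :=
  (ratr a.1 <= p.1 < ratr b.1) && (ratr a.2 <= p.2 < ratr b.2).

Definition rect a b : set (R * R) := [set p | in_rect a b p].

Definition le2 a b := (a.1 <= b.1) && (a.2 <= b.2).

(** Corners in the wrong order give the empty set, which is presented again with the ordered corners
    [0] and [0]; positivity of [volume] is available for ordered corners only. *)
Lemma rectP X : (exists a b, X = rect a b) -> exists a b, le2 a b /\ X = rect a b.
Proof.
move=> [a [b ->]]; have [ab|ab] := boolP (le2 a b); first by exists a, b.
exists 0, 0; split; first by rewrite /le2 !lexx.
have empty u v : ~~ (u.1 < v.1) || ~~ (u.2 < v.2) -> rect u v = set0.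
  move=> uv; rewrite -subset0 => p /andP[/andP[h1 h2] /andP[h3 h4]].
  by case/orP: uv => /negP; apply; rewrite -(ltr_rat R);
     [exact: le_lt_trans h1 h2|exact: le_lt_trans h3 h4].
rewrite !empty ?ltxx//.
by move: ab; rewrite /le2 negb_and -!ltNge => /orP[|] /ltW; rewrite leNgt => ->; rewrite ?orbT.
Qed.

Lemma ltr_ratr_min (x : R) u v :
  (x < ratr (Num.min u v)) = (x < ratr u) && (x < ratr v).
Proof.
have [uv|/ltW vu] := leP u v.
  by rewrite andb_idr// => /lt_le_trans; apply; rewrite ler_rat.
by rewrite andb_idl// => /lt_le_trans; apply; rewrite ler_rat.
Qed.

Lemma ler_ratr_max (x : R) u v :
  (ratr (Num.max u v) <= x) = (ratr u <= x) && (ratr v <= x).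
Proof.
have [uv|/ltW vu] := leP u v.
  by rewrite andb_idl//; apply: le_trans; rewrite ler_rat.
by rewrite andb_idr//; apply: le_trans; rewrite ler_rat.
Qed.

Definition rects : set (set (R * R)) := [set X | exists a b, X = rect a b].

Lemma rects0 : rects set0.
Proof.
exists 0, 0; apply/esym; rewrite -subset0 => p /andP[/andP[h1 h2] _].
by have := le_lt_trans h1 h2; rewrite ltxx.
Qed.

Lemma rectI a b c d : rect a b `&` rect c d =
  rect (Num.max a.1 c.1, Num.max a.2 c.2) (Num.min b.1 d.1, Num.min b.2 d.2).
Proof.
apply/seteqP; split => p; rewrite /rect /in_rect/= !ltr_ratr_min !ler_ratr_max.
  by move=> [/andP[/andP[-> ->]/andP[-> ->]] /andP[/andP[-> ->]/andP[-> ->]]].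
by move=> /andP[/andP[/andP[-> ->]/andP[-> ->]]/andP[/andP[-> ->]/andP[-> ->]]].
Qed.

Lemma rectsI : setI_closed rects.
Proof.
by move=> _ _ [a [b ->]] [c [d ->]]; rewrite rectI; do 2 eexists.
Qed.

(** The difference is cut into the parts left and right of the removed rectangle and, between them,
    the parts below and above it. [k] computes the piece of a point, which yields both covering and
    disjointness. *)
Lemma rectsD : semi_setD_closed rects.
Proof.
move=> _ _ [a [b ->]] /rectP[c [d [/andP[cd1 cd2] ->]]].
pose X i := match i with
  | 0 => rect a (Num.min b.1 c.1, b.2)
  | 1 => rect (Num.max a.1 d.1, a.2) b
  | 2 => rect (Num.max a.1 c.1, a.2) (Num.min b.1 d.1, Num.min b.2 c.2)
  | _ => rect (Num.max a.1 c.1, Num.max a.2 d.2) (Num.min b.1 d.1, b.2)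
  end%N.
pose k (p : R * R) := (if (p.1 < ratr c.1)%R then 0 else if (ratr d.1 <= p.1)%R then 1 else
  if (p.2 < ratr c.2)%R then 2 else 3)%N.
have cdx (x : R) : ratr d.1 <= x -> x < ratr c.1 = false.
  by move=> dx; apply/negbTE; rewrite -leNgt (le_trans _ dx)// ler_rat.
have cdy (x : R) : ratr d.2 <= x -> x < ratr c.2 = false.
  by move=> dx; apply/negbTE; rewrite -leNgt (le_trans _ dx)// ler_rat.
have Xk i p : (i < 4)%N -> X i p -> k p = i.
  case: i => [|[|[|[|//]]]] _; rewrite /X/= /rect /in_rect/=
    ?ltr_ratr_min ?ler_ratr_max /k.
  - by move=> /andP[/andP[_ /andP[_ ->]]].
  - by move=> /andP[/andP[/andP[_ dp]]]; rewrite dp (cdx _ dp).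
  - move=> /andP[/andP[/andP[_ cp] /andP[_ pd]] /andP[_ /andP[_ ->]]].
    by rewrite ltNge cp /= leNgt pd.
  - move=> /andP[/andP[/andP[_ cp] /andP[_ pd]] /andP[/andP[_ dp] _]].
    by rewrite ltNge cp /= leNgt pd/= (cdy _ dp).
exists (X @` `I_4); split.
- exact/finite_image/finite_II.
- by move=> _ [i _ <-]; case: i => [|[|[|?]]]; do 2 eexists.
- apply/seteqP; split => [p [/andP[/andP[h1 h2] /andP[h3 h4]] cd]|p [_ [i i4 <-] Xp]].
    exists (X (k p)); first by exists (k p) => //; rewrite /k; do ?[case: ifP => // _].
    rewrite /k; have [pc|pc] := ltP p.1 (ratr c.1).
      by rewrite /X/= /rect /in_rect/= ?ltr_ratr_min h1 h2 h3 h4 pc.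
    have [pd|pd] := leP (ratr d.1) p.1.
      by rewrite /X/= /rect /in_rect/= ?ler_ratr_max h1 h2 h3 h4 pd.
    have [qc|qc] := ltP p.2 (ratr c.2); rewrite /X/= /rect /in_rect/=
        !(ltr_ratr_min, ler_ratr_max) h1 h2 h3 h4 pc pd ?qc//= andbT.
    rewrite leNgt; apply/negP => qd; apply: cd.
    by rewrite /rect /in_rect/= pc pd qc qd.
  split.
    move: i i4 Xp => [|[|[|[|//]]]] _; rewrite /X/= /rect /in_rect/=
      ?ltr_ratr_min ?ler_ratr_max.
    - by move=> /andP[/andP[-> /andP[-> _]] ->].
    - by move=> /andP[/andP[/andP[-> _] ->] ->].
    - by move=> /andP[/andP[/andP[-> _] /andP[-> _]] /andP[-> /andP[-> _]]].
    - by move=> /andP[/andP[/andP[-> _] /andP[-> _]] /andP[/andP[-> _] ->]].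
  have := Xk _ _ i4 Xp; rewrite /k /rect /in_rect/= => ki /andP[/andP[h1 h2] /andP[h3 h4]].
  move: ki; rewrite ltNge h1 leNgt h2/= ltNge h3/= => ki; rewrite -ki in Xp.
  move: Xp; rewrite /X/= /rect /in_rect/= !ler_ratr_max => /andP[_ /andP[/andP[_]]].
  by rewrite leNgt h4.
- move=> _ _ [i i4 <-] [j j4 <-] [p [Xip Xjp]].
  by rewrite -(Xk _ _ i4 Xip) -(Xk _ _ j4 Xjp).
Qed.

End RationalRectangles.

Lemma sorted_cover (l : seq rat) : exists (x : rat) (s : seq rat),
  path <%R x s /\ {subset l <= x :: s}.
Proof.
(* The extra [0] makes the list nonempty. *)
have sl : sorted <%R (sort <=%R (undup (0 :: l))) by rewrite sort_lt_sorted undup_uniq.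
have ll : {subset 0 :: l <= sort <=%R (undup (0 :: l))}.
  by move=> u; rewrite mem_sort mem_undup.
case: (sort _ _) sl ll => [|x s] sl ll; first by have := ll 0 (mem_head _ _).
by exists x, s; split => // u ul; apply: ll; rewrite inE ul orbT.
Qed.

(** * Finite additivity and subadditivity of rectangle volumes *)

Section GridWeights.
Variables (R : realType) (H : rat -> rat -> R).

Definition volume (a b : rat * rat) : R :=
  H b.1 b.2 - H a.1 b.2 - (H b.1 a.2 - H a.1 a.2).

Hypothesis volume_ge0 : forall a b, le2 a b -> 0 <= volume a b.

(* A finite family of rectangles only sees the discrete measure that puts the
   volume of each cell of a common grid at the lower left corner of the cell;
   finite additivity and subadditivity of [volume] follow. *)
Lemma volume_grid (Q : seq ((rat * rat) * (rat * rat))) :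
  (forall ab, ab \in Q -> le2 ab.1 ab.2) ->
  exists s : seq ((R * R) * R), (forall z, z \in s -> 0 <= z.2) /\
    forall ab, ab \in Q ->
      volume ab.1 ab.2 = \sum_(z <- s) z.2 *+ in_rect ab.1 ab.2 z.1.
Proof.
move=> Qle.
have [x [xs [pxs Qx]]] := sorted_cover
  (flatten [seq [:: ab.1.1; ab.2.1] | ab : (rat * rat) * (rat * rat) <- Q]).
have [y [ys [pys Qy]]] := sorted_cover
  (flatten [seq [:: ab.1.2; ab.2.2] | ab : (rat * rat) * (rat * rat) <- Q]).
pose cell (p q : rat * rat) : (R * R) * R :=
  ((ratr p.1, ratr q.1), volume (p.1, q.1) (p.2, q.2)).
exists [seq cell p q | p <- zip (x :: xs) xs, q <- zip (y :: ys) ys]; split.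
  move=> z /allpairsP[[p q] [/= pz qz ->]]; apply: volume_ge0.
  have /andP[_ /ltW h1] := zip_path_lt pxs pz.
  by have /andP[_ /ltW h2] := zip_path_lt pys qz; rewrite /le2 /= h1.
move=> [a b] abQ; have /andP[/= ab1 ab2] := Qle _ abQ.
have [ax bx] : a.1 \in x :: xs /\ b.1 \in x :: xs.
  by split; apply: Qx; apply/flattenP; exists [:: a.1; b.1];
    rewrite ?inE ?eqxx ?orbT//; apply/mapP; exists (a, b).
have [ay by_] : a.2 \in y :: ys /\ b.2 \in y :: ys.
  by split; apply: Qy; apply/flattenP; exists [:: a.2; b.2];
    rewrite ?inE ?eqxx ?orbT//; apply/mapP; exists (a, b).
(* Telescoping in the first coordinate between fixed heights [a.2] and [b.2]; each increment is then
   telescoped in the second. *)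
rewrite big_allpairs_dep/=; transitivity (\sum_(p <- zip (x :: xs) xs)
    ((H p.2 b.2 - H p.2 a.2) - (H p.1 b.2 - H p.1 a.2)) *+ (a.1 <= p.1 < b.1)%R).
  have := telescope_itv (fun u => H u b.2 - H u a.2) pxs ax bx ab1 => ->.
  by rewrite /volume; ring.
apply: eq_bigr => p _.
have -> : H p.2 b.2 - H p.2 a.2 - (H p.1 b.2 - H p.1 a.2) =
    (fun v => H p.2 v - H p.1 v) b.2 - (fun v => H p.2 v - H p.1 v) a.2.
  by rewrite /=; ring.
rewrite -(telescope_itv (fun v => H p.2 v - H p.1 v) pys ay by_ ab2) -sumrMnl.
apply: eq_bigr => q _.
rewrite /in_rect/= !ler_rat !ltr_rat.
by rewrite -(mulnb (a.1 <= p.1 < b.1)) mulnC mulrnA.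
Qed.

(** By [volume_grid] it is enough to compare multiplicities at each weighted point: a point of
    [rect a b] is counted at least once on the right. *)
Lemma volume_subset_sum (I : eqType) (r : seq I) (f : I -> (rat * rat) * (rat * rat)) a b :
  le2 a b -> (forall i, i \in r -> le2 (f i).1 (f i).2) ->
  (forall p : R * R, rect a b p -> exists2 i, i \in r & rect (f i).1 (f i).2 p) ->
  volume a b <= \sum_(i <- r) volume (f i).1 (f i).2.
Proof.
move=> ab fr cov; have [|s [s0 sE]] := @volume_grid ((a, b) :: map f r).
  by move=> cd; rewrite inE => /predU1P[->//|/mapP[i ir ->]]; exact: fr.
rewrite (sE (a, b)) ?mem_head// [leRHS]big_seq.
rewrite [leRHS](eq_bigr (fun i => \sum_(z <- s) z.2 *+ in_rect (f i).1 (f i).2 z.1)); last first.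
  by move=> i ir; rewrite (sE (f i))// inE map_f ?orbT.
rewrite -big_seq exchange_big/= big_seq [leRHS]big_seq; apply: ler_sum => z zs.
rewrite sumrMnr; apply: ler_wpMn2l; first exact: s0.
have [/cov[i ir fi]|//] := boolP (in_rect a b z.1).
rewrite (big_rem i)//=; move: fi; rewrite /rect/= => ->.
exact: leq_addr.
Qed.

Lemma volume_trivIset_sum n (f : nat -> (rat * rat) * (rat * rat)) a b :
  le2 a b -> (forall i, le2 (f i).1 (f i).2) ->
  trivIset setT (fun i => rect (R := R) (f i).1 (f i).2) ->
  rect a b = \big[setU/set0]_(i < n) rect (f i).1 (f i).2 :> set (R * R) ->
  volume a b = \sum_(i < n) volume (f i).1 (f i).2.
Proof.
move=> ab fle ftriv abE; have [|s [s0 sE]] := @volume_grid ((a, b) :: map f (iota 0 n)).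
  by move=> cd; rewrite inE => /predU1P[->//|/mapP[i ir ->]]; exact: fle.
rewrite (sE (a, b)) ?mem_head//.
rewrite (eq_bigr (fun i : 'I_n => \sum_(z <- s) z.2 *+ in_rect (f i).1 (f i).2 z.1)); last first.
  by move=> i _; rewrite (sE (f i))// inE map_f ?orbT// mem_iota/=.
rewrite exchange_big/=; apply: eq_bigr => z _; rewrite sumrMnr; congr (_ *+ _).
have [abz|abz] := boolP (in_rect a b z.1).
  have : rect a b z.1 by [].
  rewrite abE -(bigcup_mkord n (fun i => rect (f i).1 (f i).2)) => -[i /= iltn fi].
  rewrite (bigD1 (Ordinal iltn))//= big1 ?addn0 => [|j jneqi].
    by move: fi; rewrite /rect/= => ->.
  apply/eqP; rewrite eqb0; apply/negP => fj; move/negP: jneqi; apply.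
  apply/eqP/val_inj => /=; apply: (ftriv _ _ I I); first by exists z.1; split.
rewrite big1// => i _; apply/eqP; rewrite eqb0; apply: contra abz => fi.
suff : rect a b z.1 by [].
by rewrite abE -(bigcup_mkord n (fun i => rect (f i).1 (f i).2)); exists i => /=.
Qed.

(** Each presentation is a one-element cover of the other. This makes [volume] a function of the
    set. *)
Lemma volume_rect_inj a b a' b' : le2 a b -> le2 a' b' ->
  rect a b = rect a' b' :> set (R * R) -> volume a b = volume a' b'.
Proof.
move=> ab ab' E; apply/eqP; rewrite eq_le.
apply/andP; split.
  have := @volume_subset_sum unit [:: tt] (fun _ => (a', b')) a b ab.
  rewrite big_seq1; apply => // p; rewrite E => abp; by exists tt.
have := @volume_subset_sum unit [:: tt] (fun _ => (a, b)) a' b' ab'.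
rewrite big_seq1; apply => // p; rewrite -E => abp; by exists tt.
Qed.

End GridWeights.

(** * Two-dimensional Stieltjes measures *)

Section StieltjesMeasure2.
Variable R : realType.
Implicit Types (H : rat -> rat -> R) (a b : rat * rat).

(** Arguments are rational because a generic chain meets only countably many requirements. *)
Record distribution2 H : Prop := Distribution2 {
  d2_volume : forall a b, le2 a b -> 0 <= volume H a b ;
  d2_ge0 : forall u v, 0 <= H u v ;
  d2_le1 : forall u v, H u v <= 1 ;
  d2_homol : forall u u' v, u <= u' -> H u v <= H u' v ;
  d2_homor : forall u v v', v <= v' -> H u v <= H u v' ;
  d2_left : forall u v e, 0 < e ->
    exists u' v', [/\ u' < u, v' < v & H u v - e <= H u' v'] ;
  d2_infl : forall v e, 0 < e -> exists u, H u v <= e ;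
  d2_infr : forall u e, 0 < e -> exists v, H u v <= e ;
  d2_sup : forall e, 0 < e -> exists u v, 1 - e <= H u v
}.

Variable H : rat -> rat -> R.
Hypothesis dH : distribution2 H.

Lemma volume_le_corner a b : le2 a b -> volume H a b <= H b.1 b.2.
Proof.
move=> /andP[_ ab2]; rewrite /volume.
by have := d2_homor dH a.1 ab2; have := d2_ge0 dH b.1 a.2; lra.
Qed.

(** Left continuity at [b]; the maxima with [a] keep the corners ordered. The closed box from [a] to
    [b'] is then a compact part of [rect a b]. *)
Lemma volume_shrink a b e : 0 < e -> a.1 < b.1 -> a.2 < b.2 ->
  exists b', [/\ le2 a b', b'.1 < b.1, b'.2 < b.2 &
                 volume H a b - e <= volume H a b'].
Proof.
move=> e0 ab1 ab2; have [u [v [ub vb uvb]]] := d2_left dH b.1 b.2 e0.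
have u1 : u <= Num.max a.1 u by rewrite le_max lexx orbT.
have v1 : v <= Num.max a.2 v by rewrite le_max lexx orbT.
have u2 : Num.max a.1 u < b.1 by rewrite gt_max ab1.
have v2 : Num.max a.2 v < b.2 by rewrite gt_max ab2.
exists (Num.max a.1 u, Num.max a.2 v); split => //.
  by rewrite /le2/= !le_max !lexx.
rewrite /volume/=; have := d2_homol dH v u1; have := d2_homor dH (Num.max a.1 u) v1.
by have := d2_homol dH a.2 (ltW u2); have := d2_homor dH a.1 (ltW v2); lra.
Qed.

(** Left continuity at the corners [(a.1, b.2)] and [(b.1, a.2)], with error [e / 2] each. The open
    box from [a'] to [b] then contains [rect a b]. *)
Lemma volume_enlarge a b e : 0 < e -> le2 a b ->
  exists a', [/\ a'.1 < a.1, a'.2 < a.2 & volume H a' b <= volume H a b + e].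
Proof.
move=> e0 /andP[ab1 ab2]; have e20 : 0 < e / 2 by rewrite divr_gt0.
have [u [v' [ua vb uE]]] := d2_left dH a.1 b.2 e20.
have [u' [v [ub va vE]]] := d2_left dH b.1 a.2 e20.
exists (u, v); split => //; rewrite /volume/=.
have := d2_homor dH u (ltW vb); have := d2_homol dH v (ltW ub).
have := d2_homol dH v (ltW ua); have := d2_homor dH a.1 (ltW va).
by lra.
Qed.

(* [compact_cover] needs a pointed topological type, and the library gives no such
   structure to the product [R * R]. *)
Definition rect_type : Type := (R * R)%type.
HB.instance Definition _ := Topological.copy rect_type (R * R)%type.
HB.instance Definition _ := Pointed.copy rect_type (R * R)%type.
HB.instance Definition _ := @isSemiRingOfSets.Build default_measure_display
  rect_type (@rects R) (@rects0 R) (@rectsI R) (@rectsD R).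

(** The value does not depend on the presentation, by [volume_rect_inj]; the default 0 concerns only
    sets that are not rectangles. *)
Definition rect_content (X : set rect_type) : \bar R :=
  (xget 0 [set v | exists a b, [/\ le2 a b, X = rect a b & v = volume H a b]])%:E.

Lemma rect_contentE a b : le2 a b -> rect_content (rect a b) = (volume H a b)%:E.
Proof.
move=> ab; congr (_%:E).
have [a' [b' [ab' E ->]]] : [set v | exists a' b',
    [/\ le2 a' b', rect a b = rect a' b' :> set (R * R) & v = volume H a' b']]
    (xget 0 [set v | exists a' b',
    [/\ le2 a' b', rect a b = rect a' b' :> set (R * R) & v = volume H a' b']]).
  by apply: (xgetI _ (_ : _ (volume H a b))); exists a, b.
by apply: (volume_rect_inj (d2_volume dH)); rewrite // E.
Qed.

Lemma rect_content_ge0 X : (0 <= rect_content X)%E.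
Proof.
rewrite lee_fin; case: xgetP => [_ _ [a [b [ab _ ->]]]|//].
exact: d2_volume.
Qed.

Lemma rect_content_semi_additive : measure_function.semi_additive rect_content.
Proof.
move=> F n mF tF mU.
have /choice[f fE] i : exists ab : (rat * rat) * (rat * rat),
    le2 ab.1 ab.2 /\ F i = rect ab.1 ab.2.
  by have [a [b ?]] := rectP (mF i); exists (a, b).
have FE : F = fun i => rect (f i).1 (f i).2 by apply/funext => i; case: (fE i).
have fle i : le2 (f i).1 (f i).2 by case: (fE i).
have [a [b [ab abE]]] := rectP mU.
rewrite abE rect_contentE// (@volume_trivIset_sum R H (d2_volume dH) n f)//.
- by rewrite -sumEFin; apply: eq_bigr => i _; rewrite FE rect_contentE.
- by rewrite -FE.
- by rewrite -abE FE.
Qed.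

(** The Heine-Borel argument: the closed box [K] inside [A] is covered by open boxes [O i] around
    the [F i], and a finite subcover reduces the claim to [volume_subset_sum]. *)
Lemma rect_content_sigma_subadditive :
  measurable_subset_sigma_subadditive rect_content.
Proof.
move=> A F mF /rectP[a [b [ab AE]]] AF.
have /choice[f fE] i : exists ab : (rat * rat) * (rat * rat),
    le2 ab.1 ab.2 /\ F i = rect ab.1 ab.2.
  by have [c [d ?]] := rectP (mF i); exists (c, d).
have fle i : le2 (f i).1 (f i).2 by case: (fE i).
have muF i : rect_content (F i) = (volume H (f i).1 (f i).2)%:E.
  by have [_ ->] := fE i; rewrite rect_contentE.
rewrite AE rect_contentE//.
have [abs|] := boolP ((a.1 < b.1) && (a.2 < b.2)); last first.
  move=> nab; suff -> : volume H a b = 0.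
    by apply: nneseries_ge0 => i _ _; exact: rect_content_ge0.
  move: ab nab => /andP[]; rewrite !le_eqVlt /volume.
  by move=> /orP[/eqP ->|->] /orP[/eqP ->|->] //= _; ring.
have /andP[ab1 ab2] := abs.
apply/lee_addgt0Pr => e e0; have e20 : 0 < e / 2 by rewrite divr_gt0.
have [b' [ab' b1 b2 vab]] := volume_shrink e20 ab1 ab2.
have /choice[c cE] i : exists c : rat * rat,
    [/\ c.1 < (f i).1.1, c.2 < (f i).1.2 & volume H c (f i).2 <=
       volume H (f i).1 (f i).2 + (e / 2) / (2 ^ i.+1)%:R].
  by apply: volume_enlarge; rewrite // divr_gt0// ltr0n expn_gt0.
have cle i : le2 (c i) (f i).2.
  have [c1 c2 _] := cE i; have /andP[f1 f2] := fle i.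
  by rewrite /le2 !(le_trans (ltW _) f1, le_trans (ltW _) f2).
pose K : set (R * R) := `[ratr a.1, ratr b'.1] `*` `[ratr a.2, ratr b'.2].
pose O i : set (R * R) := `](ratr (c i).1 : R), ratr (f i).2.1[ `*`
                          `](ratr (c i).2 : R), ratr (f i).2.2[.
have cK : compact K by apply: compact_setX; exact: segment_compact.
have oO i : open (O i).
  rewrite (_ : O i = fst @^-1` `](ratr (c i).1 : R), ratr (f i).2.1[ `&`
                     snd @^-1` `](ratr (c i).2 : R), ratr (f i).2.2[)//.
  by apply: openI; apply: open_comp; rewrite ?(@interval_open R)// => x _;
     [exact: cvg_fst|exact: cvg_snd].
have KO : K `<=` \bigcup_i O i.
  move=> p [/=]; rewrite !in_itv/= => /andP[p1 p2] /andP[p3 p4].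
  have : A p.
    rewrite AE /rect /in_rect/= p1 p3 (le_lt_trans p2) ?ltr_rat//.
    by rewrite (le_lt_trans p4) ?ltr_rat.
  move=> /AF[i _]; have [_ ->] := fE i => /andP[/andP[q1 q2] /andP[q3 q4]].
  exists i => //; have [c1 c2 _] := cE i.
  by split; rewrite /= in_itv/= ?q2 ?q4 andbT;
     [apply: lt_le_trans q1|apply: lt_le_trans q3]; rewrite ltr_rat.
have : @cover_compact rect_type K by rewrite -(@compact_cover rect_type).
move=> /(_ _ setT O (fun i _ => oO i) KO)[D _ KD].
have vle : volume H a b' <= \sum_(i <- enum_fset D) volume H (c i) (f i).2.
  apply: (volume_subset_sum (R := R) (d2_volume dH) (f := fun i => (c i, (f i).2))) => //= p.
  move=> /andP[/andP[p1 p2] /andP[p3 p4]].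
  have /KD[i /= iD [/=]] : K p by split; rewrite /= in_itv/= ?p1 ?p3 ltW.
  rewrite !in_itv/= => /andP[q1 q2] /andP[q3 q4]; exists i => //.
  by rewrite /rect /in_rect/= q2 q4 !ltW.
(* Half of [e] pays for shrinking [A], the other half, split geometrically, for enlarging the
   [F i]. *)
apply: (@le_trans _ _ (\sum_(i <oo) (rect_content (F i) + ((e / 2) / (2 ^ i.+1)%:R)%:E)
    + (e / 2)%:E)%E); last first.
  have -> : e%:E = ((e / 2)%:E + (e / 2)%:E)%E by rewrite -EFinD -splitr.
  rewrite addeA leeD2r//.
  apply: epsilon_trick; last exact: ltW.
  by move=> i; exact: rect_content_ge0.
apply: (@le_trans _ _ ((\sum_(i <- enum_fset D) volume H (c i) (f i).2)%:E + (e / 2)%:E)%E).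
  by rewrite -EFinD lee_fin; move: vab vle; lra.
rewrite leeD2r// -sumEFin.
apply: (@le_trans _ _ (\sum_(i <- enum_fset D) (rect_content (F i) + ((e / 2) / (2 ^ i.+1)%:R)%:E))%E).
  by apply: lee_sum => i _; rewrite muF -EFinD lee_fin; have [_ _] := cE i.
rewrite nneseries_esum; last first.
  move=> i _; apply: adde_ge0; first exact: rect_content_ge0.
  by rewrite lee_fin divr_ge0// ltW.
by rewrite esum_ge//; exists [set` D] => //; rewrite fsbig_finite//= set_fsetK.
Qed.

HB.instance Definition _ := isContent.Build _ rect_type R rect_content
  rect_content_ge0 rect_content_semi_additive.
HB.instance Definition _ := Content_SigmaSubAdditive_isMeasure.Build _ R rect_type
  rect_content rect_content_sigma_subadditive.

Let rect_measurable : set (set rect_type) := measurable.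
Let T : measurableType _ := g_sigma_algebraType rect_measurable.
Let mu : {measure set T -> \bar R} := measure_extension rect_content.

Lemma measurable_rect a b : measurable (rect a b : set T).
Proof. by apply: sub_sigma_algebra; exists a, b. Qed.

Lemma mu_rect a b : le2 a b -> mu (rect a b) = (volume H a b)%:E.
Proof.
move=> ab; rewrite -rect_contentE//; apply: measurable_mu_extE.
by exists a, b.
Qed.

Lemma mu_bigcup_le (A : nat -> set T) M : (forall i, measurable (A i)) ->
  (forall i, A i `<=` A i.+1) -> (forall i, (mu (A i) <= M)%E) ->
  (mu (\bigcup_i A i) <= M)%E.
Proof.
move=> mA Ai AM.
have ndA : {homo A : n m / (n <= m)%N >-> (n <= m)%O}.
  by apply/nondecreasing_seqP => i; apply/subsetPset; exact: Ai.
have cA := nondecreasing_cvg_mu (mu := mu) mA (bigcupT_measurable _ mA) ndA.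
rewrite -(cvg_lim _ cA)//; apply: lime_le.
  by apply/cvg_ex; eexists; exact: cA.
by apply: nearW => i; exact: AM.
Qed.

(** An open set is the countable union of the rational rectangles it contains; quadruples whose
    rectangle is not contained in it contribute the empty set. *)
Lemma borel2_measurable (A : set (R * R)) : borel2 A -> measurable (A : set T).
Proof.
apply: smallest_sub.
  split; [exact: measurable0|by move=> B mB; rewrite setTD; exact: measurableC|].
  by move=> B mB; exact: bigcupT_measurable.
move=> U /= oU.
rewrite (_ : U = \bigcup_(q1 : rat) \bigcup_(q2 : rat) \bigcup_(q3 : rat) \bigcup_(q4 : rat)
    [set p | rect (q1, q2) (q3, q4) p /\ rect (q1, q2) (q3, q4) `<=` U]).
  do 4 (apply: bigcupT_measurable_rat => ?).
  set S := rect _ _; have [SU|SU] := pselect (S `<=` U).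
    rewrite (_ : [set p | _] = S); first exact: measurable_rect.
    by apply/seteqP; split => p //; case.
  rewrite (_ : [set p | _] = set0); first exact: measurable0.
  by rewrite -subset0 => p [].
apply/seteqP; split => [p Up|p [q1 _ [q2 _ [q3 _ [q4 _ [Sp SU]]]]]]; last exact: SU.
have /nbhs_ballP[e /= e0 eU] : nbhs p U by exact: open_nbhs_nbhs.
have /rat_in_itvoo[q1] : p.1 - e < p.1 by rewrite gtrBl.
have /rat_in_itvoo[q2] : p.2 - e < p.2 by rewrite gtrBl.
have /rat_in_itvoo[q3] : p.1 < p.1 + e by rewrite ltrDl.
have /rat_in_itvoo[q4] : p.2 < p.2 + e by rewrite ltrDl.
rewrite !in_itv/= => /andP[h41 h42] /andP[h31 h32] /andP[h21 h22] /andP[h11 h12].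
exists q1 => //; exists q2 => //; exists q3 => //; exists q4 => //; split.
  by rewrite /rect /in_rect/= h41 h31 !ltW.
move=> [x y] /andP[/=/andP[x1 x2] /andP[y1 y2]]; apply: eU; split => /=;
  rewrite /ball/= ltr_distlC.
  by rewrite (lt_le_trans h11 x1) (lt_trans x2 h32).
by rewrite (lt_le_trans h21 y1) (lt_trans y2 h42).
Qed.

Definition quadrant (s t : R) : set (R * R) := `]-oo, s[ `*` `]-oo, t[.

Lemma quadrantP (s t : R) (p : R * R) : quadrant s t p <-> p.1 < s /\ p.2 < t.
Proof. by rewrite /quadrant/= !in_itv. Qed.

Lemma borel2_quadrant (s t : R) : borel2 (quadrant s t).
Proof.
apply: sub_sigma_algebra => /=.
rewrite (_ : quadrant s t = fst @^-1` `]-oo, s[ `&` snd @^-1` `]-oo, t[)//.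
by apply: openI; apply: open_comp; rewrite ?(@interval_open R)// => x _;
   [exact: cvg_fst|exact: cvg_snd].
Qed.

(** From above, the quadrant is an increasing union of rectangles with upper corner [(u, v)], each
    of volume at most [H u v]. From below, one rectangle with its lower corner far enough away loses
    at most [e]. *)
Lemma mu_quadrant (u v : rat) : mu (quadrant (ratr u) (ratr v)) = (H u v)%:E.
Proof.
pose a k : rat * rat := (u - k%:R, v - k%:R).
have auv k : le2 (a k) (u, v) by rewrite /le2/= !gerBl !ler0n.
have quadE : quadrant (ratr u) (ratr v) = \bigcup_k rect (a k) (u, v).
  apply/seteqP; split => [p /quadrantP[p1 p2]|p [k _ /andP[/andP[_ p1] /andP[_ p2]]]];
    last exact/quadrantP.
  pose k := (maxn (Num.bound (ratr u - p.1)) (Num.bound (ratr v - p.2))).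
  exists k => //; rewrite /rect /in_rect/= p1 p2 !rmorphB/= !rmorph_nat.
  rewrite !lerBlDr !andbT -!lerBlDl; apply/andP; split; apply: ltW.
    by apply: (lt_le_trans (unstable.ltr_bound _)); rewrite ler_nat leq_maxl.
  by apply: (lt_le_trans (unstable.ltr_bound _)); rewrite ler_nat leq_maxr.
apply/eqP; rewrite eq_le; apply/andP; split.
  rewrite quadE; apply: mu_bigcup_le => [k|k p|k].
  - exact: measurable_rect.
  - rewrite /rect /in_rect/= => /andP[/andP[h ->] /andP[h' ->]].
    rewrite !andbT; apply/andP; split.
      by apply: le_trans h; rewrite ler_rat lerB// ler_nat.
    by apply: le_trans h'; rewrite ler_rat lerB// ler_nat.
  - by rewrite mu_rect// lee_fin (volume_le_corner (auv k)).
apply/lee_addgt0Pr => e e0; have e20 : 0 < e / 2 by rewrite divr_gt0.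
have [u' u'E] := d2_infl dH v e20; have [v' v'E] := d2_infr dH u e20.
pose c := (Num.min u' u, Num.min v' v).
have cuv : le2 c (u, v) by rewrite /le2/= !ge_min !lexx !orbT.
apply: (@le_trans _ _ (mu (rect c (u, v)) + e%:E)%E).
  rewrite mu_rect// -EFinD lee_fin /volume/=.
  have := d2_homol dH v (_ : Num.min u' u <= u'); rewrite ge_min lexx => /(_ isT).
  have := d2_homor dH u (_ : Num.min v' v <= v'); rewrite ge_min lexx => /(_ isT).
  by have := d2_ge0 dH (Num.min u' u) (Num.min v' v); lra.
rewrite leeD2r//; apply: le_measure; rewrite ?inE.
- exact: measurable_rect.
- exact: (borel2_measurable (borel2_quadrant _ _)).
- by move=> p /andP[/andP[_ p1] /andP[_ p2]]; exact/quadrantP.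
Qed.

Lemma mu_setT : mu setT = 1%E.
Proof.
apply/eqP; rewrite eq_le; apply/andP; split.
  rewrite (_ : setT = \bigcup_k quadrant (ratr k%:R) (ratr k%:R)).
    apply: mu_bigcup_le => [k|k p|k].
    - exact: (borel2_measurable (borel2_quadrant _ _)).
    - move=> /quadrantP[p1 p2]; apply/quadrantP; rewrite !rmorph_nat in p1 p2 *.
      by split; [apply: lt_le_trans p1 _|apply: lt_le_trans p2 _]; rewrite ler_nat.
    - by rewrite mu_quadrant lee_fin d2_le1.
  apply/seteqP; split => // p _.
  exists (maxn (Num.bound p.1) (Num.bound p.2)) => //; apply/quadrantP.
  by rewrite rmorph_nat; split; apply: (lt_le_trans (unstable.ltr_bound _));
     rewrite ler_nat ?leq_maxl ?leq_maxr.
apply/lee_addgt0Pr => e e0; have [u [v uv]] := d2_sup dH e0.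
apply: (@le_trans _ _ (mu (quadrant (ratr u) (ratr v)) + e%:E)%E).
  by rewrite mu_quadrant -EFinD lee_fin -lerBlDr.
rewrite leeD2r//; apply: le_measure; rewrite ?inE//.
exact: (borel2_measurable (borel2_quadrant _ _)).
Qed.

Lemma distribution2_probability : exists P : set (R * R) -> R,
  [/\ P setT = 1, forall A, borel2 A -> 0 <= P A,
      forall A B, borel2 A -> borel2 B -> A `&` B = set0 -> P (A `|` B) = P A + P B,
      forall A : nat -> set (R * R), (forall i, borel2 (A i)) ->
        (forall i, A i `<=` A i.+1) -> forall e, 0 < e ->
        exists i, P (\bigcup_i A i) - e <= P (A i) &
      forall u v, P (quadrant (ratr u) (ratr v)) = H u v].
Proof.
have mu_fin (A : set T) : borel2 A -> mu A \is a fin_num.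
  move=> bA; rewrite ge0_fin_numE ?measure_ge0//.
  apply: (@le_lt_trans _ _ (mu setT)); last by rewrite mu_setT ltry.
  by apply: le_measure; rewrite ?inE//; exact: borel2_measurable.
exists (fun A => fine (mu A)); split.
- by rewrite mu_setT.
- by move=> A _; apply/fine_ge0/measure_ge0.
- move=> A B bA bB AB; rewrite measureU//; [|exact: borel2_measurable..].
  by rewrite fineD ?mu_fin.
- move=> A bA Ai e e0; apply: contrapT => no.
  have bU : borel2 (\bigcup_i A i).
    have [_ _ +] : sigma_algebra setT (@borel2 R) by exact: smallest_sigma_algebra.
    exact.
  have : (mu (\bigcup_i A i) <= (fine (mu (\bigcup_i A i)) - e)%:E)%E.
    apply: mu_bigcup_le => // i; first exact: borel2_measurable.
    rewrite -(fineK (mu_fin _ (bA i))) lee_fin leNgt; apply/negP => /ltW h.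
    by apply: no; exists i.
  by rewrite -{1}(fineK (mu_fin _ bU)) lee_fin lerDl oppr_ge0 leNgt e0.
- by move=> u v; rewrite mu_quadrant.
Qed.

End StieltjesMeasure2.

(** * Generation of the Borel sets by rational quadrants *)

Section BorelQuadrants.
Variable R : realType.

Lemma quadrantI (s t s' t' : R) :
  quadrant s t `&` quadrant s' t' = quadrant (Num.min s s') (Num.min t t').
Proof.
apply/seteqP; split => p; rewrite !quadrantP !lt_min.
  by move=> [/quadrantP[-> ->] /quadrantP[-> ->]].
by move=> [/andP[? ?] /andP[? ?]]; split; exact/quadrantP.
Qed.

Lemma quadrant_subset (s t s' t' : R) : s <= s' -> t <= t' ->
  quadrant s t `<=` quadrant s' t'.
Proof.
by move=> ss' tt' p /quadrantP[p1 p2]; apply/quadrantP; split;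
  [exact: lt_le_trans ss'|exact: lt_le_trans tt'].
Qed.

Definition rational_quadrants : set (set (R * R)) :=
  [set A | exists u v : rat, A = quadrant (ratr u) (ratr v)].

(** By [borel2_measurable] it is enough to generate rational rectangles, and each is a quadrant
    minus two others. *)
Lemma borel2_sub_rational_quadrants : @borel2 R `<=` <<s rational_quadrants >>.
Proof.
have sQ : sigma_algebra setT <<s rational_quadrants >> by exact: smallest_sigma_algebra.
move=> A /borel2_measurable mA; apply: smallest_sub mA => // _ [a [b ->]].
pose S : measurableType _ := g_sigma_algebraType rational_quadrants.
have mq (u v : rat) : measurable (quadrant (ratr u) (ratr v) : set S).
  by apply: sub_sigma_algebra; exists u, v.
rewrite (_ : rect a b = quadrant (ratr b.1) (ratr b.2) `\`
   (quadrant (ratr a.1) (ratr b.2) `|` quadrant (ratr b.1) (ratr a.2))).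
  exact: (measurableD (mq _ _) (measurableU _ _ (mq _ _) (mq _ _))).
apply/seteqP; split => p.
  move=> /andP[/andP[p1 p2] /andP[p3 p4]]; split; first exact/quadrantP.
  by move=> [|] /quadrantP[]; rewrite !ltNge ?p1 ?p3.
move=> [/quadrantP[p2 p4] np]; rewrite /rect /in_rect/= p2 p4 !andbT.
by apply/andP; split; rewrite leNgt; apply/negP => lt; apply: np;
   [left|right]; exact/quadrantP.
Qed.

(** Dynkin's theorem, as rational quadrants are stable under intersection. *)
Lemma borel2_ind (C : set (R * R) -> Prop) :
  (forall u v : rat, C (quadrant (ratr u) (ratr v))) -> C setT ->
  (forall A B, borel2 A -> borel2 B -> B `<=` A -> C A -> C B -> C (A `\` B)) ->
  (forall A : nat -> set (R * R), (forall i, borel2 (A i)) ->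
    (forall i, A i `<=` A i.+1) -> (forall i, C (A i)) -> C (\bigcup_i A i)) ->
  forall A, borel2 A -> C A.
Proof.
move=> Cq CT CD CU A /borel2_sub_rational_quadrants bA.
have sB : sigma_algebra setT (@borel2 R) by exact: smallest_sigma_algebra.
have bD A' B' : borel2 A' -> borel2 B' -> borel2 (A' `\` B' : set (R * R)).
  pose S : measurableType _ := g_sigma_algebraType [set A : set (R * R) | open A].
  by move=> mA mB; exact: (@measurableD _ S).
suff : [set A | borel2 A /\ C A] A by case.
move: A bA; apply: lambda_system_subset => //.
- move=> _ _ [u [v ->]] [u' [v' ->]]; exists (Num.min u u'), (Num.min v v').
  by rewrite quadrantI; congr quadrant; rewrite /Order.min ltr_rat; case: ifP.
- split => //.
  + by split => //; rewrite -(setD0 setT); case: sB => b0 bC _; exact: bC.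
  + by move=> A B BA [bA CA] [bB CB]; split; [exact: bD|exact: CD].
  + move=> A ndA hA; have Ai i : A i `<=` A i.+1 by exact/subsetPset/ndA.
    split; last by apply: CU => // i; case: (hA i).
    by case: sB => _ _; apply => i; case: (hA i).
- by move=> _ [u [v ->]]; split; [exact: borel2_quadrant|exact: Cq].
Qed.

(** Turns left limits at real points into countable suprema, which generic states preserve. The
    sequence is the running maximum of rationals within [k.+1%:R^-1] of [s]. *)
Lemma rat_seq_lt (s : R) : exists r : nat -> rat,
  [/\ {homo r : i j / (i <= j)%N >-> i <= j}, forall k, ratr (r k) < s &
      forall x, x < s -> exists k, x < ratr (r k)].
Proof.
have /choice[q qs] k : exists q : rat, s - k.+1%:R^-1 < ratr q < s.
  have /rat_in_itvoo[q] : s - k.+1%:R^-1 < s by rewrite gtrBl invr_gt0 ltr0n.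
  by rewrite in_itv/=; exists q.
pose r := fix r k := if k is k'.+1 then Num.max (r k') (q k) else q 0.
exists r; split.
- by apply/nondecreasing_seqP => k /=; rewrite le_max lexx.
- elim=> [|k IH] /=; first by case/andP: (qs 0).
  by rewrite /Num.max; case: ifP => // _; case/andP: (qs k.+1).
- move=> x; rewrite -subr_gt0 => /ltr_add_invr[k]; rewrite add0r => kx; exists k.
  have [qk _] := andP (qs k).
  have qr : q k <= r k by case: k {kx qk} => //= k; rewrite le_max lexx orbT.
  rewrite -(ler_rat R) in qr; apply: lt_le_trans qr; apply: lt_trans qk.
  by rewrite ltrBrDr -ltrBrDl.
Qed.

End BorelQuadrants.

(** * Stieltjes measures with values in a lattice-ordered group *)

Section LatticeValuedStieltjes.
Variables (R : realType) (G : porderZmodType).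
Hypotheses (hG : is_lgroup G) (hGc : dedekind_sigma_complete G).

(** Limits are stated as extremal bounds: [lgd_left], [lgd_infl], [lgd_infr] and [lgd_sup] give one
    half of each universal property, the other being monotonicity or [lgd_itv]. *)
Record lg_distribution2 (c : G) (h : R -> R -> G) : Prop := LgDistribution2 {
  lgd_volume : forall a1 b1 a2 b2, a1 <= b1 -> a2 <= b2 ->
    0 <= h b1 b2 - h a1 b2 - (h b1 a2 - h a1 a2) ;
  lgd_itv : forall s t, 0 <= h s t <= c ;
  lgd_homol : forall s s' t, s <= s' -> h s t <= h s' t ;
  lgd_homor : forall s t t', t <= t' -> h s t <= h s t' ;
  lgd_left : forall s t y,
    (forall s' t', s' < s -> t' < t -> h s' t' <= y) -> h s t <= y ;
  lgd_infl : forall t y, (forall s, y <= h s t) -> y <= 0 ;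
  lgd_infr : forall s y, (forall t, y <= h s t) -> y <= 0 ;
  lgd_sup : forall y, (forall s t, h s t <= y) -> c <= y
}.

Variables (c : G) (h : R -> R -> G).
Hypothesis hh : lg_distribution2 c h.

Let c_ge0 : 0 <= c.
Proof. by have /andP[+ +] := lgd_itv hh 0 0; exact: le_trans. Qed.

Let h_ge0 s t : 0 <= h s t. Proof. by case/andP: (lgd_itv hh s t). Qed.

Let h_bounded s t : bounded_by_unit c (h s t).
Proof. exact/bounded_by_unit_itv/(lgd_itv hh). Qed.

Let h_homo s t s' t' : s <= s' -> t <= t' -> h s t <= h s' t'.
Proof. by move=> ss' tt'; apply: (le_trans (lgd_homol hh _ ss')); exact: (lgd_homor hh). Qed.

Lemma lgd_sup_seq (s t : R) (r r' : nat -> rat) :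
  (forall k, ratr (r k) < s) -> (forall x, x < s -> exists k, x < ratr (r k)) ->
  (forall k, ratr (r' k) < t) -> (forall x, x < t -> exists k, x < ratr (r' k)) ->
  {homo r : i j / (i <= j)%N >-> i <= j} -> {homo r' : i j / (i <= j)%N >-> i <= j} ->
  supremums (range (fun k => h (ratr (r k)) (ratr (r' k)))) (h s t).
Proof.
move=> rs rx r't r'x ndr ndr'; split => [_ [k _ <-]|y ub].
  by apply: h_homo; exact: ltW.
apply: (lgd_left hh) => s' t' /rx[i ri] /r'x[j rj].
apply: le_trans (ub _ (ex_intro2 _ _ (maxn i j) I erefl)).
apply: h_homo; apply: ltW; [apply: lt_le_trans ri _|apply: lt_le_trans rj _];
  rewrite ler_rat; [apply: ndr|apply: ndr']; by rewrite ?leq_maxl ?leq_maxr.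
Qed.

Let H w (u v : rat) : R := state R c w (h (ratr u) (ratr v)).

Lemma generic_volume (a b : rat * rat) : generic c (fun w =>
  volume (H w) a b = state R c w
    (h (ratr b.1) (ratr b.2) - h (ratr a.1) (ratr b.2) -
    (h (ratr b.1) (ratr a.2) - h (ratr a.1) (ratr a.2)))).
Proof.
have bB x y : bounded_by_unit c x -> bounded_by_unit c y -> bounded_by_unit c (x - y).
  by move=> bx by_; apply: bounded_by_unitD => //; exact: bounded_by_unitN.
have g1 := generic_stateB R hG c_ge0 (h_bounded (ratr b.1) (ratr b.2))
  (h_bounded (ratr a.1) (ratr b.2)).
have g2 := generic_stateB R hG c_ge0 (h_bounded (ratr b.1) (ratr a.2))
  (h_bounded (ratr a.1) (ratr a.2)).
have g3 := generic_stateB R hG c_ge0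
  (bB _ _ (h_bounded (ratr b.1) (ratr b.2)) (h_bounded (ratr a.1) (ratr b.2)))
  (bB _ _ (h_bounded (ratr b.1) (ratr a.2)) (h_bounded (ratr a.1) (ratr a.2))).
apply: generic_imp2 (generic_and g1 g2) g3 => w cw [e1 e2] ->.
by rewrite e1 e2.
Qed.

(** Over the rationals each axiom is a countable family of requirements: generic additivity for
    volumes, [generic_state_sup] for limits. Positivity and monotonicity hold for every chain. *)
Lemma generic_distribution2 : generic c (fun w => distribution2 (H w)).
Proof.
have gvol := generic_forall (fun ab : (rat * rat) * (rat * rat) => generic_volume ab.1 ab.2).
have gleft : generic c (fun w => forall uv : rat * rat, forall e, 0 < e ->
    exists u' v', [/\ u' < uv.1, v' < uv.2 & H w uv.1 uv.2 - e <= H w u' v']).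
  apply: generic_forall => -[u v] /=.
  have [r [ndr rs rx]] := rat_seq_lt (ratr u : R).
  have [r' [ndr' rs' rx']] := rat_seq_lt (ratr v : R).
  have ndh : {homo (fun k => h (ratr (r k)) (ratr (r' k))) : i j / (i <= j)%N >-> i <= j}.
    by move=> i j ij; apply: h_homo; rewrite ler_rat; [exact: ndr|exact: ndr'].
  have := generic_state_sup R hG c_ge0 ndh (lgd_sup_seq rs rx rs' rx' ndr ndr')
    (h_bounded _ _) (fun j => h_bounded _ _).
  apply: generic_imp => w cw hw e e0; have [j hj] := hw e e0; exists (r j), (r' j).
  by rewrite -!(ltr_rat R).
have ndneg : {homo (fun k : nat => ratr (- k%:R) : R) : i j / (i <= j)%N >-> j <= i}.
  by move=> i j ij; rewrite ler_rat lerN2 ler_nat.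
(* An infimum 0 at minus infinity is treated as the supremum 0 of the opposites along the negative
   integers. *)
have ginf (g : R -> G) : (forall x, bounded_by_unit c (g x)) ->
    {homo g : s s' / s <= s'} -> (forall x, 0 <= g x) ->
    (forall y, (forall s, y <= g s) -> y <= 0) ->
    generic c (fun w => forall e, 0 < e -> exists u : rat, state R c w (g (ratr u)) <= e).
  move=> bg ndg g0 ginf.
  have sup0 : supremums (range (fun k : nat => - g (ratr (- k%:R)))) 0.
    split => [_ [k _ <-]|y ub]; first by rewrite lg_oppr_le0.
    rewrite -lg_oppr_le0//; apply: ginf => s.
    apply: (@le_trans _ _ (g (ratr (- (Num.bound s)%:R)))).
      by rewrite -lg_leN2E// opprK; apply: ub; exists (Num.bound s).
    by apply: ndg; rewrite rmorphN/= rmorph_nat lerNl ltW// unstable.ltrNbound.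
  have b0 : bounded_by_unit c 0 by apply: bounded_by_unit_itv; rewrite // lexx.
  have ndh : {homo (fun k : nat => - g (ratr (- k%:R))) : i j / (i <= j)%N >-> i <= j}.
    by move=> i j ij; rewrite lg_leN2E//; apply: ndg; exact: ndneg.
  have := generic_state_sup R hG c_ge0 ndh sup0 b0 (fun j => bounded_by_unitN hG (bg _)).
  apply: generic_imp => w cw hw e e0; have [j hj] := hw e e0; exists (- j%:R).
  (* The values of an element and of its opposite add up to at most 0, so a lower bound for the
     latter bounds the former from above. *)
  have := state_superD R hG c_ge0 cw (bg (ratr (- j%:R))) (bounded_by_unitN hG (bg (ratr (- j%:R)))).
  by move: hj; rewrite subrr !state0//; lra.
have ginfl : generic c (fun w => forall v : rat, forall e, 0 < e -> exists u, H w u v <= e).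
  apply: generic_forall => v; apply: (ginf (fun s => h s (ratr v))) => //.
  - by move=> s s' ss'; exact: (lgd_homol hh).
  - exact: (lgd_infl hh).
have ginfr : generic c (fun w => forall u : rat, forall e, 0 < e -> exists v, H w u v <= e).
  apply: generic_forall => u; apply: (ginf (fun s => h (ratr u) s)) => //.
  - by move=> s s' ss'; exact: (lgd_homor hh).
  - exact: (lgd_infr hh).
have gsup : generic c (fun w => forall e, 0 < e -> exists u v, 1 - e <= H w u v).
  have supc : supremums (range (fun k : nat => h (ratr k%:R) (ratr k%:R))) c.
    split => [_ [k _ <-]|y ub]; first by case/andP: (lgd_itv hh (ratr k%:R) (ratr k%:R)).
    apply: (lgd_sup hh) => s t.
    apply: le_trans (ub _ (ex_intro2 _ _ (maxn (Num.bound s) (Num.bound t)) I erefl)).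
    by apply: h_homo; rewrite rmorph_nat; apply: (le_trans (ltW (unstable.ltr_bound _)));
      rewrite ler_nat ?leq_maxl ?leq_maxr.
  have bc : bounded_by_unit c c by apply: bounded_by_unit_itv; rewrite // lexx andbT.
  have ndh : {homo (fun k : nat => h (ratr k%:R) (ratr k%:R)) : i j / (i <= j)%N >-> i <= j}.
    by move=> i j ij; apply: h_homo; rewrite ler_rat ler_nat.
  have := generic_state_sup R hG c_ge0 ndh supc bc (fun j => h_bounded _ _).
  apply: generic_imp => w cw hw e e0; have [j hj] := hw e e0; exists j%:R, j%:R.
  by move: hj; rewrite state_unit.
apply: generic_imp2 (generic_and gvol gleft) (generic_and (generic_and ginfl ginfr) gsup).
move=> w cw [wvol wleft] [[winfl winfr] wsup]; split => //.
- move=> a b /andP[ab1 ab2]; rewrite (wvol (a, b)); apply: state_ge0 => //; last first.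
    by apply: (lgd_volume hh); rewrite ler_rat.
  by apply: (bounded_by_unitD hG); [|apply: (bounded_by_unitN hG)];
    apply: (bounded_by_unitD hG) => //; exact: bounded_by_unitN.
- by move=> u v; exact: state_ge0.
- move=> u v; rewrite -(state_unit R hG c_ge0 cw); apply: le_state => //.
    by apply: bounded_by_unit_itv; rewrite // lexx andbT.
  by case/andP: (lgd_itv hh (ratr u) (ratr v)).
- by move=> u u' v uu'; apply: le_state => //; apply: (lgd_homol hh); rewrite ler_rat.
- by move=> u v v' vv'; apply: le_state => //; apply: (lgd_homor hh); rewrite ler_rat.
- by move=> u v; exact: (wleft (u, v)).
Qed.


(** By [borel2_ind], every Borel set [A] has some [g] between 0 and [c] whose state is generically
    [P w A]. By [generic_state_le] this [g] is unique, so identities for [nu] can be checked on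
    generic states. *)
Theorem lattice_stieltjes2 : exists nu : set (R * R) -> G,
  [/\ nu setT = c, forall A, borel2 A -> 0 <= nu A,
      forall A B, borel2 A -> borel2 B -> A `&` B = set0 ->
        nu (A `|` B) = nu A + nu B,
      forall A : nat -> set (R * R), (forall i, borel2 (A i)) ->
        (forall i, A i `<=` A i.+1) ->
        supremums (range (fun i => nu (A i))) (nu (\bigcup_i A i)) &
      forall s t, nu (quadrant s t) = h s t].
Proof.
have sB : sigma_algebra setT (@borel2 R) by exact: smallest_sigma_algebra.
pose S : measurableType _ := g_sigma_algebraType [set A : set (R * R) | open A].
have bT : borel2 [set: R * R] by exact: (@measurableT _ S).
have bD A B : borel2 A -> borel2 B -> borel2 (A `\` B : set (R * R)).
  by move=> bA bB; exact: (@measurableD _ S).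
have bU A B : borel2 A -> borel2 B -> borel2 (A `|` B : set (R * R)).
  by move=> bA bB; exact: (@measurableU _ S).
have bUn (A : nat -> set (R * R)) : (forall i, borel2 (A i)) -> borel2 (\bigcup_i A i).
  by case: sB => _ _; exact.
have bounded x : 0 <= x <= c -> bounded_by_unit c x by exact: bounded_by_unit_itv.
(* [H w] is a distribution function only generically; for other chains [P w] is a dummy zero
   function. *)
have /choice[P PP] w : exists P : set (R * R) -> R, distribution2 (H w) ->
  [/\ P setT = 1, forall A, borel2 A -> 0 <= P A,
      forall A B, borel2 A -> borel2 B -> A `&` B = set0 -> P (A `|` B) = P A + P B,
      forall A : nat -> set (R * R), (forall i, borel2 (A i)) ->
        (forall i, A i `<=` A i.+1) -> forall e, 0 < e ->
        exists i, P (\bigcup_i A i) - e <= P (A i) &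
      forall u v, P (quadrant (ratr u) (ratr v)) = H w u v].
  have [dw|ndw] := pselect (distribution2 (H w)); last by exists (fun _ => 0).
  by have [P] := distribution2_probability dw; exists P.
have PD w A B : distribution2 (H w) -> borel2 A -> borel2 B -> B `<=` A ->
    P w (A `\` B) = P w A - P w B.
  move=> /PP[_ _ Padd _ _] bA bB BA.
  rewrite -{2}(setDUK BA) Padd//; last exact: setDIK.
    by rewrite addrAC subrr add0r.
  exact: bD.
have Ple w A B : distribution2 (H w) -> borel2 A -> borel2 B -> B `<=` A ->
    P w B <= P w A.
  move=> dw bA bB BA; rewrite -subr_ge0 -PD//.
  by have [_ P0 _ _ _] := PP _ dw; apply: P0; exact: bD.
have gd := generic_distribution2.
have sup_itv (g : nat -> G) : (forall i, 0 <= g i <= c) ->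
    exists2 s, supremums (range g) s & 0 <= s <= c.
  move=> gc; have [|||s [ub lub]] := hGc (A := range g).
  - by exists (g 0), 0.
  - by apply: sub_countable (card_image_le _ _) _; exact: countableP.
  - by exists c => _ [i _ <-]; case/andP: (gc i).
  exists s => //; apply/andP; split.
    by have /andP[g0 _] := gc 0; apply: (le_trans g0); apply: ub; exists 0.
  by apply: lub => _ [i _ <-]; case/andP: (gc i).
(* Real measures and generic states are both continuous along an increasing sequence, so the
   supremum in [G] represents the union. The order on the [g i] comes from that on the
   [P w (A i)]. *)
have Urep (A : nat -> set (R * R)) (g : nat -> G) s : (forall i, borel2 (A i)) ->
    (forall i, A i `<=` A i.+1) -> (forall i, 0 <= g i <= c) ->
    (forall i, generic c (fun w => P w (A i) = state R c w (g i))) ->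
    supremums (range g) s -> 0 <= s <= c ->
    generic c (fun w => P w (\bigcup_i A i) = state R c w s).
  move=> bA Ai gc gA gs sc.
  have Ahomo i j : (i <= j)%N -> A i `<=` A j.
    have ndA : nondecreasing_seq A by apply/nondecreasing_seqP => k; exact/subsetPset.
    by move=> ij; exact/subsetPset/ndA.
  have ndg : {homo g : i j / (i <= j)%N >-> i <= j}.
    move=> i j ij; apply: (generic_state_le (R := R) hG hGc c_ge0); [exact: bounded|exact: bounded|].
    apply: generic_imp2 (generic_and (gA i) (gA j)) gd => w cw [<- <-] dw.
    by apply: Ple => //; exact: Ahomo.
  have gsup := generic_state_sup R hG c_ge0 ndg gs (bounded _ sc) (fun i => bounded _ (gc i)).
  apply: generic_imp2 (generic_and gd gsup) (generic_forall gA) => w cw [dw wsup] wA.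
  have [_ _ _ Pcont _] := PP _ dw.
  apply/eqP; rewrite eq_le; apply/andP; split; apply/ler_addgt0Pr => e e0.
    have [i] := Pcont A bA Ai e e0; rewrite wA lerBlDr => /le_trans; apply.
    rewrite lerD2r; apply: (le_state R hG c_ge0 cw); [exact: bounded|exact: bounded|].
    by case: gs => ub _; apply: ub; exists i.
  have [i] := wsup e e0; rewrite -wA lerBlDr => /le_trans; apply.
  by rewrite lerD2r; apply: Ple => //; [exact: bUn|move=> p Ap; exists i].
have rep A : borel2 A -> exists g, 0 <= g <= c /\
    generic c (fun w => P w A = state R c w g).
  apply: (@borel2_ind R (fun A => exists g, 0 <= g <= c /\
    generic c (fun w => P w A = state R c w g))).
  - move=> u v; exists (h (ratr u) (ratr v)); split; first exact: (lgd_itv hh).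
    by apply: generic_imp gd => w cw /PP[_ _ _ _ ->].
  - exists c; split; first by rewrite c_ge0 lexx.
    by apply: generic_imp gd => w cw /PP[-> _ _ _ _]; rewrite state_unit.
  - move=> {}A B bA bB BA [g [g0 gA]] [g' [g'0 gB]]; exists (g - g'); split.
      have g'g : g' <= g.
        apply: (generic_state_le (R := R) hG hGc c_ge0); [exact: bounded|exact: bounded|].
        apply: generic_imp2 (generic_and gA gB) gd => w cw [<- <-] dw.
        exact: Ple.
      rewrite lg_ge0B//= lg_leBlDr//; have /andP[_ gc] := g0; have /andP[g'1 _] := g'0.
      by apply: (le_trans gc); rewrite -{1}(addr0 c) lg_leD2.
    have gBs := generic_stateB R hG c_ge0 (bounded _ g0) (bounded _ g'0).
    apply: generic_imp2 (generic_and gA gB) (generic_and gBs gd) => w cw.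
    by move=> [wA wB] [-> dw]; rewrite PD// wA wB.
  - move=> A' bA' A'i /choice[g gP].
    have gc i : 0 <= g i <= c by case: (gP i).
    have [s gs sc] := sup_itv g gc; exists s; split => //.
    by apply: (Urep A' g) => // i; case: (gP i).
have /choice[nu nuP] A : exists g, borel2 A -> 0 <= g <= c /\
    generic c (fun w => P w A = state R c w g).
  have [/rep[g ?]|nbA] := pselect (borel2 A); first by exists g.
  by exists 0.
have nu_itv A : borel2 A -> 0 <= nu A <= c by move=> /nuP[].
have nu_gen A : borel2 A -> generic c (fun w => P w A = state R c w (nu A)).
  by move=> /nuP[].
(* Uniqueness of the representing element, by separation of points in both directions. *)
have nu_eq A g : borel2 A -> bounded_by_unit c g ->
    generic c (fun w => P w A = state R c w g) -> nu A = g.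
  move=> bA bg gA; apply/eqP; rewrite eq_le.
  apply/andP; split; apply: (generic_state_le (R := R) hG hGc c_ge0) => //; try exact/bounded/nu_itv.
    by apply: generic_imp2 (nu_gen _ bA) gA => w cw <- <-.
  by apply: generic_imp2 (nu_gen _ bA) gA => w cw <- <-.
have nu_sup (A : nat -> set (R * R)) : (forall i, borel2 (A i)) ->
    (forall i, A i `<=` A i.+1) ->
    supremums (range (fun i => nu (A i))) (nu (\bigcup_i A i)).
  move=> bA Ai; have [s nus sc] := sup_itv (fun i => nu (A i)) (fun i => nu_itv _ (bA i)).
  rewrite (nu_eq _ s)//; [exact: bUn|exact: bounded|].
  by apply: (Urep A (fun i => nu (A i))) => // i; [exact: nu_itv|exact: nu_gen].
have nuq u v : nu (quadrant (ratr u) (ratr v)) = h (ratr u) (ratr v).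
  apply: nu_eq; [exact: borel2_quadrant|exact: h_bounded|].
  by apply: generic_imp gd => w cw /PP[_ _ _ _ ->].
exists nu; split => //.
- apply: nu_eq => //; first by apply: bounded; rewrite c_ge0 lexx.
  by apply: generic_imp gd => w cw /PP[-> _ _ _ _]; rewrite state_unit.
- by move=> A /nu_itv/andP[].
- move=> A B bA bB AB.
  have [bnA bnB] := (bounded _ (nu_itv _ bA), bounded _ (nu_itv _ bB)).
  apply: nu_eq; [exact: bU|exact: bounded_by_unitD|].
  apply: generic_imp2 (generic_and (nu_gen _ bA) (nu_gen _ bB))
    (generic_and (generic_stateD R hG c_ge0 bnA bnB) gd) => w cw [<- <-] [-> /PP[_ _ Padd _ _]].
  by rewrite Padd.
(* Only rational quadrants are known so far; a real one is an increasing union of them, and both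
   sides are suprema of the same sequence. *)
- move=> s t; have [r [ndr rs rx]] := rat_seq_lt s; have [r' [ndr' rt rx']] := rat_seq_lt t.
  have qE : quadrant s t = \bigcup_k quadrant (ratr (r k)) (ratr (r' k)).
    apply/seteqP; split => [p /quadrantP[/rx[i pi] /rx'[j pj]]|p [k _]].
      exists (maxn i j) => //; apply/quadrantP; split.
        by apply: (lt_le_trans pi); rewrite ler_rat; apply: ndr; exact: leq_maxl.
      by apply: (lt_le_trans pj); rewrite ler_rat; apply: ndr'; exact: leq_maxr.
    by apply: quadrant_subset; exact: ltW.
  have qS k : quadrant (ratr (r k) : R) (ratr (r' k)) `<=` quadrant (ratr (r k.+1)) (ratr (r' k.+1)).
    by apply: quadrant_subset; rewrite ler_rat; [exact: ndr|exact: ndr'].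
  have [] := nu_sup _ (fun k => borel2_quadrant (ratr (r k)) (ratr (r' k))) qS.
  have [] := lgd_sup_seq rs rx rt rx' ndr ndr'; rewrite -qE => ub lub ub' lub'.
  apply/eqP; rewrite eq_le; apply/andP; split.
    by apply: lub' => _ [k _ <-]; rewrite nuq; apply: ub; exists k.
  by apply: lub => _ [k _ <-]; rewrite -nuq; apply: ub'; exists k.
Qed.

End LatticeValuedStieltjes.

(** * Spectral resolutions on the perfect MV-algebra *)

Section PerfectMVOrder.
Variable G : porderZmodType.
Implicit Types a b : perfect_mv G.

Definition mv_int a : int := (gval a : int * G).1.
Definition mv_grp a : G := (gval a : int * G).2.

Lemma zlex_leE (x y : zlex G) :
  (x <= y) = ((x : int * G).1 < (y : int * G).1) ||
             ((x : int * G).1 == (y : int * G).1) && ((x : int * G).2 <= (y : int * G).2).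
Proof.
rewrite [LHS](_ : _ = (x.1 <= y.1) && ((y.1 <= x.1) ==> (x.2 <= y.2)))//.
by case: ltgtP.
Qed.

Lemma zlex_eqP (x y : zlex G) : (x : int * G).1 = (y : int * G).1 ->
  (x : int * G).2 = (y : int * G).2 -> x = y.
Proof. by case: x y => [? ?] [? ?] /= -> ->. Qed.

Lemma mv_leE a b : (a <= b) =
  (mv_int a < mv_int b) || (mv_int a == mv_int b) && (mv_grp a <= mv_grp b).
Proof. by rewrite -zlex_leE. Qed.

Lemma mv_eqP a b : mv_int a = mv_int b -> mv_grp a = mv_grp b -> a = b.
Proof. by move=> i g; apply: val_inj; exact: zlex_eqP. Qed.

Lemma mvP a : (mv_int a = 0 /\ 0 <= mv_grp a) \/ (mv_int a = 1 /\ mv_grp a <= 0).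
Proof.
have /andP[] := gvalP a; rewrite !zlex_leE/= -/(mv_int a) -/(mv_grp a).
case: (mv_int a) (mv_grp a) => [[|[|k]]|k] g //=.
- by left.
- by right.
Qed.

Lemma mv_exists0 (g : G) : 0 <= g -> exists a, mv_int a = 0 /\ mv_grp a = g.
Proof.
move=> g0; have aP : 0 <= ((0, g) : zlex G) <= zlex1 G by rewrite !zlex_leE/= g0.
by exists (Gamma aP).
Qed.

Lemma mv_exists1 (g : G) : g <= 0 -> exists a, mv_int a = 1 /\ mv_grp a = g.
Proof.
move=> g0; have aP : 0 <= ((1, g) : zlex G) <= zlex1 G by rewrite !zlex_leE/= g0.
by exists (Gamma aP).
Qed.

Lemma mv_coradE (hG : is_lgroup G) a : mv_corad a <-> mv_int a = 1.
Proof.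
split=> [[g _]|]; first by rewrite /mv_int => ->.
move=> a1; have [[]|[_ g0]] := mvP a; first by rewrite a1.
exists (- mv_grp a); first by rewrite lg_oppr_ge0.
by rewrite opprK; move: a1; rewrite /mv_int /mv_grp; case: (gval a) => ? ? /= ->.
Qed.

Lemma supremums_unique (A : set (perfect_mv G)) a b :
  supremums A a -> supremums A b -> a = b.
Proof.
by move=> [ua la] [ub lb]; apply/eqP; rewrite eq_le la// lb.
Qed.

End PerfectMVOrder.

Section SpectralResolution.
Variables (R : realType) (G : porderZmodType).
Hypotheses (hG : is_lgroup G) (hGc : dedekind_sigma_complete G).
Variable F : R * R -> perfect_mv G.
Hypothesis hF : spectral_resolution2 F.

Let n s t : int := mv_int (F (s, t)).
Let f s t : G := mv_grp (F (s, t)).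

(** By left continuity, [F (s', t')] bounds all the values whose supremum is [F (s, t)]. *)
Lemma sr2_homo s t s' t' : s <= s' -> t <= t' -> F (s, t) <= F (s', t').
Proof.
move=> ss' tt'; have [ub' _] := sr2_left_continuous hF s' t'.
have [_ lub] := sr2_left_continuous hF s t; apply: lub => _ [[u v] /= [us vt] <-].
by apply: ub'; exists (u, v) => //=; rewrite (lt_le_trans us) ?(lt_le_trans vt).
Qed.

Lemma sr2_box a1 b1 a2 b2 : a1 <= b1 -> a2 <= b2 ->
  0 < n b1 b2 - n a1 b2 - n b1 a2 + n a1 a2 \/
  n b1 b2 - n a1 b2 - n b1 a2 + n a1 a2 = 0 /\
  0 <= f b1 b2 - f a1 b2 - f b1 a2 + f a1 a2.
Proof.
move=> ab1 ab2; have := sr2_volume hF ab1 ab2; rewrite zlex_leE.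
by move=> /orP[box|/andP[/eqP box1 box2]]; [left|right; split].
Qed.

Variables (p : R * R) (m : perfect_mv G).
Hypothesis hp : characteristic_point F p.
Hypothesis hm :
  infimums [set F q | q in [set q : R * R | p.1 < q.1 /\ p.2 < q.2]] m.
Hypothesis m_corad : mv_corad m.

Lemma sr2_int_homo s t s' t' : s <= s' -> t <= t' -> n s t = 1 -> n s' t' = 1.
Proof.
move=> ss' tt' n1; have := sr2_homo ss' tt'; rewrite mv_leE -/(n s t) n1.
by rewrite /n; have [[-> _]|[-> _]] := mvP (F (s', t')).
Qed.

(** Otherwise the box with these four corners would have integer volume -1. With [sr2_int_homo], the
    points where [n] is 1 are thus closed under coordinatewise minimum. *)
Lemma sr2_int_lattice s t s' t' : s <= s' -> t' <= t ->
  n s t = 1 -> n s' t' = 1 -> n s t' = 1.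
Proof.
move=> ss' tt' n1 n1'; have n2 : n s' t = 1 by exact: sr2_int_homo n1.
have := sr2_box ss' tt'; rewrite n1 n1' n2 subrr sub0r.
by rewrite /n; have [[-> _]|[-> _]] := mvP (F (s, t')); [case=> -[]|].
Qed.

(** Above [p], the infima provide one point with [n] equal to 1 left of [s] and one below [t], which
    [sr2_int_lattice] combines. Conversely, if [n s t] is 1 elsewhere, all values strictly to the
    lower left are in the radical, and [F (s, t)] cannot be their supremum. *)
Lemma sr2_intE s t : n s t = ((p.1 < s) && (p.2 < t))%:R.
Proof.
have [[lb1 glb1] [lb2 glb2]] := hp.
have T1P q : mv_corad (F q) <-> n q.1 q.2 = 1.
  by rewrite mv_coradE//; case: q.
have [/andP[ps pt]|npq] := boolP (_ && _).
  have [s1 [t1 [s1s n1]]] : exists s1 t1, s1 < s /\ n s1 t1 = 1.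
    apply: contrapT => no; move: ps; rewrite ltNge => /negP; apply.
    apply: glb1 => _ [[s1 t1] /T1P/= n1 <-]; rewrite leNgt; apply/negP => lt.
    by apply: no; exists s1, t1.
  have [s2 [t2 [t2t n2]]] : exists s2 t2, t2 < t /\ n s2 t2 = 1.
    apply: contrapT => no; move: pt; rewrite ltNge => /negP; apply.
    apply: glb2 => _ [[s2 t2] /T1P/= n2 <-]; rewrite leNgt; apply/negP => lt.
    by apply: no; exists s2, t2.
  have [t12|/ltW t21] := leP t1 t2.
    by apply: (sr2_int_homo _ _ n1); rewrite ltW// (le_lt_trans t12).
  have [s12|/ltW s21] := leP s1 s2.
    by apply: (sr2_int_homo _ _ (sr2_int_lattice s12 t21 n1 n2)); exact: ltW.
  by apply: (sr2_int_homo _ _ n2); rewrite ltW// (le_lt_trans s21).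
rewrite /n; have [[-> //]|[n1 _]] := mvP (F (s, t)).
have [[u [v [us vt n1uv]]]|no] :=
    pselect (exists u v, [/\ u < s, v < t & n u v = 1]).
  case/negP: npq; apply/andP; split.
    apply: le_lt_trans us; apply: lb1; exists (u, v) => //.
    exact/T1P.
  apply: le_lt_trans vt; apply: lb2; exists (u, v) => //.
  exact/T1P.
have n0 u v : u < s -> v < t -> n u v = 0 /\ 0 <= f u v.
  move=> us vt; have [//|[n1uv _]] := mvP (F (u, v)).
  by case: no; exists u, v.
have [ub lub] := sr2_left_continuous hF s t.
(* Elements of the radical cannot have a supremum [(1, f s t)]: for [g > 0],
   [(1, f s t - g)] is a smaller upper bound, and if [G] is trivial, [0] is. *)
have [[g g0]|triv] := pselect (exists g : G, 0 < g).
  have f0 : f s t - g <= 0.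
    have [[]|[_ f0]] := mvP (F (s, t)); first by rewrite n1.
    by rewrite lg_subr_le0// (le_trans f0)// ltW.
  have [a [a1 ag]] := mv_exists1 f0.
  have : F (s, t) <= a.
    apply: lub => _ [[u v] /= [us vt] <-]; have [nuv _] := n0 u v us vt.
    by rewrite mv_leE a1 -/(n u v) nuv.
  rewrite mv_leE n1 a1 ltxx eqxx/= ag -/(f s t) => /(lg_ge0B hG).
  by rewrite addrAC subrr add0r lg_oppr_ge0// => /(lt_le_trans g0); rewrite ltxx.
have : F (s, t) <= mv0.
  apply: lub => _ [[u v] /= [us vt] <-]; have [nuv fuv] := n0 u v us vt.
  rewrite mv_leE -/(n u v) nuv/= -/(f u v).
  have [->//|fne] := eqVneq (f u v) 0.
  by case: triv; exists (f u v); rewrite lt_def fne.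
by rewrite mv_leE n1.
Qed.

Let box (g : R -> R -> G) a1 b1 a2 b2 := g b1 b2 - g a1 b2 - (g b1 a2 - g a1 a2).

Lemma boxDl (g : R -> R -> G) a1 x b1 a2 b2 :
  box g a1 b1 a2 b2 = box g a1 x a2 b2 + box g x b1 a2 b2.
Proof.
rewrite /box !opprB [RHS](AC ((2*2)*(2*2)) (((5*2)*(3*8))*((1*6)*(7*4))))%AC/=.
by rewrite !subrr !addr0.
Qed.

Lemma boxDr (g : R -> R -> G) a1 b1 a2 x b2 :
  box g a1 b1 a2 b2 = box g a1 b1 a2 x + box g a1 b1 x b2.
Proof. by rewrite /box [RHS]addrC addrA subrK. Qed.

(** By [sr2_intE], the integer volume of a half-open box vanishes unless the box contains [p], so
    lexicographic positivity passes to the group part. *)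
Lemma sr2_grp_box_ge0 a1 b1 a2 b2 : a1 <= b1 -> a2 <= b2 ->
  ~~ ((a1 <= p.1 < b1) && (a2 <= p.2 < b2)) -> 0 <= box f a1 b1 a2 b2.
Proof.
move=> ab1 ab2 nbox; have := sr2_box ab1 ab2.
have -> : n b1 b2 - n a1 b2 - n b1 a2 + n a1 a2 = 0.
  rewrite !sr2_intE; move: nbox; rewrite (leNgt a1 p.1) (leNgt a2 p.2).
  have : p.1 < a1 -> p.1 < b1 by move=> /lt_le_trans; exact.
  have : p.2 < a2 -> p.2 < b2 by move=> /lt_le_trans; exact.
  case: (p.1 < a1); case: (p.1 < b1); case: (p.2 < a2); case: (p.2 < b2) => // h1 h2;
    by (have := h1 isT) || (have := h2 isT).
by case=> [|[_ fbox]]; [rewrite ltxx|rewrite /box opprB addrA addrAC].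
Qed.

Let lg_lerDl (x y : G) : 0 <= x -> y <= x + y.
Proof. by move=> x0; rewrite -{1}(add0r y) lg_leD2. Qed.

Let lg_lerDr (x y : G) : 0 <= y -> x <= x + y.
Proof. by move=> x0; rewrite -{1}(addr0 x) lg_leD2. Qed.

(** Each of the four strips removed in passing to the smaller box misses [p], so its volume is
    nonnegative by [sr2_grp_box_ge0]. *)
Lemma sr2_grp_box_homo a1 b1 a2 b2 b1' b2' : a1 <= p.1 -> a2 <= p.2 ->
  p.1 < b1' -> b1' <= b1 -> p.2 < b2' -> b2' <= b2 ->
  box f p.1 b1' p.2 b2' <= box f a1 b1 a2 b2.
Proof.
move=> ap1 ap2 pb1 bb1 pb2 bb2.
have pb1' := lt_le_trans pb1 bb1; have pb2' := lt_le_trans pb2 bb2.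
apply: (@le_trans _ _ (box f p.1 b1 a2 b2)); last first.
  rewrite (boxDl f a1 p.1); apply: lg_lerDl; apply: sr2_grp_box_ge0 => //.
    exact: ltW (le_lt_trans ap2 pb2').
  by rewrite ltxx andbF.
apply: (@le_trans _ _ (box f p.1 b1 p.2 b2)); last first.
  rewrite (boxDr f _ _ a2 p.2); apply: lg_lerDl; apply: sr2_grp_box_ge0 => //.
    exact: ltW.
  by rewrite ltxx !andbF.
apply: (@le_trans _ _ (box f p.1 b1' p.2 b2)); last first.
  rewrite (boxDl f p.1 b1' b1); apply: lg_lerDr; apply: sr2_grp_box_ge0 => //.
    exact: ltW.
  by rewrite leNgt pb1.
rewrite (boxDr f _ _ p.2 b2' b2); apply: lg_lerDr; apply: sr2_grp_box_ge0 => //.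
  exact: ltW.
by rewrite !(leNgt b2') pb2 andbF.
Qed.

Let f_ge0 s t : ~~ ((p.1 < s) && (p.2 < t)) -> 0 <= f s t.
Proof.
move=> /negbTE npst; have := sr2_intE s t; rewrite npst /n /f.
by have [[_ //]|[-> _]] := mvP (F (s, t)).
Qed.

Let f_le0 s t : p.1 < s -> p.2 < t -> f s t <= 0.
Proof.
move=> ps pt; have := sr2_intE s t; rewrite ps pt /n /f.
by have [[-> _]|[_ //]] := mvP (F (s, t)).
Qed.

Let f_homo s t s' t' : s <= s' -> t <= t' ->
  ((p.1 < s) && (p.2 < t)) = ((p.1 < s') && (p.2 < t')) -> f s t <= f s' t'.
Proof.
move=> ss' tt' e; have := sr2_homo ss' tt'.
by rewrite mv_leE -/(n s t) -/(n s' t') !sr2_intE e ltxx eqxx.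
Qed.

Let m_le s t : p.1 < s -> p.2 < t -> mv_grp m <= f s t.
Proof.
move=> ps pt; have [lb _] := hm.
have : m <= F (s, t) by apply: lb; exists (s, t).
by rewrite mv_leE -/(n s t) sr2_intE ps pt; move/(mv_coradE hG): m_corad => ->.
Qed.

(* Only an upper bound of the mass outside [p] is needed; it need not be sharp,
   since an excess of [c] is absorbed by [nu] at the point [p]. *)
Let c := - mv_grp m + f p.1 (p.2 + 1) + f (p.1 + 1) p.2.
Let h s t := f s t + c *+ ((p.1 < s) && (p.2 < t)).

Let c_geNm : - mv_grp m <= c.
Proof.
by rewrite /c -addrA; apply: lg_lerDr; rewrite lg_addr_ge0// f_ge0// ltxx ?andbF.
Qed.

(** After shrinking to a box with lower corner [p] and sides at most 1, the sum with [c] is a sum of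
    four nonnegative terms. The three summands of [c] offset the upper corner and the two mixed
    corners; the fourth term is the value at [p]. *)
Lemma sr2_grp_box_geNc a1 b1 a2 b2 : a1 <= p.1 < b1 -> a2 <= p.2 < b2 ->
  0 <= box f a1 b1 a2 b2 + c.
Proof.
move=> /andP[ap1 pb1] /andP[ap2 pb2].
have [p1 p2] : p.1 < p.1 + 1 /\ p.2 < p.2 + 1 by rewrite !ltrDl.
pose b1' := Num.min b1 (p.1 + 1); pose b2' := Num.min b2 (p.2 + 1).
have [pb1' b11 b12] : [/\ p.1 < b1', b1' <= b1 & b1' <= p.1 + 1].
  by rewrite lt_min pb1 p1 !ge_min !lexx orbT.
have [pb2' b21 b22] : [/\ p.2 < b2', b2' <= b2 & b2' <= p.2 + 1].
  by rewrite lt_min pb2 p2 !ge_min !lexx orbT.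
have box_le := sr2_grp_box_homo ap1 ap2 pb1' b11 pb2' b21.
apply: (@le_trans _ _ (box f p.1 b1' p.2 b2' + c)); last exact: lg_leD2.
rewrite /box /c opprB (AC (2*2*3) ((1*5)*(6*2)*(7*4)*3))%AC/=.
apply: (lg_addr_ge0 hG); [apply: (lg_addr_ge0 hG); [apply: (lg_addr_ge0 hG)|]|];
  rewrite ?(lg_subr_ge0 hG)//.
- exact: m_le.
- by apply: f_homo; rewrite // ltxx.
- by apply: f_homo; rewrite // ltxx !andbF.
- by apply: f_ge0; rewrite ltxx.
Qed.

Lemma sr2_lg_distribution2 : lg_distribution2 c h.
Proof.
have hbox a1 b1 a2 b2 : a1 <= b1 -> a2 <= b2 -> 0 <= box h a1 b1 a2 b2.
  move=> ab1 ab2; have -> : box h a1 b1 a2 b2 = box f a1 b1 a2 b2 +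
      box (fun s t => c *+ ((p.1 < s) && (p.2 < t))) a1 b1 a2 b2.
    by rewrite /box /h !opprB !opprD (AC ((2*2)*(2*2)) (((1*3)*(5*7))*((2*4)*(6*8))))%AC.
  have [/andP[/andP[h1 h2] /andP[h3 h4]]|nb] :=
      boolP ((a1 <= p.1 < b1) && (a2 <= p.2 < b2)).
    rewrite {2}/box h2 h4 (ltNge p.1 a1) h1 (ltNge p.2 a2) h3 /= ?mulr0n ?subr0 ?mulr1n.
    by apply: sr2_grp_box_geNc; apply/andP.
  rewrite [X in _ + X](_ : _ = 0) ?addr0; first exact: sr2_grp_box_ge0.
  rewrite /box; move: nb; rewrite (leNgt a1 p.1) (leNgt a2 p.2).
  have : p.1 < a1 -> p.1 < b1 by move=> /lt_le_trans; exact.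
  have : p.2 < a2 -> p.2 < b2 by move=> /lt_le_trans; exact.
  case: (p.1 < a1); case: (p.1 < b1); case: (p.2 < a2); case: (p.2 < b2);
    rewrite ?mulr0n ?mulr1n ?subrr ?subr0 // => h1 h2;
    by (have := h1 isT) || (have := h2 isT).
(* At height [u], not above [p.2], the jump is absent and [f] is monotone; the box between heights
   [u] and [t] transfers this to [t]. *)
have hl s s' t : s <= s' -> h s t <= h s' t.
  move=> ss'; pose u := Num.min t p.2.
  have [ut up] : u <= t /\ u <= p.2 by rewrite !ge_min !lexx orbT.
  rewrite -(lg_subr_ge0 hG); apply: (@le_trans _ _ (h s' u - h s u)); last first.
    by rewrite -(lg_subr_ge0 hG); exact: hbox.
  rewrite lg_subr_ge0// /h !(ltNge p.2) up !andbF !addr0.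
  by apply: f_homo; rewrite // !(ltNge p.2) up !andbF.
have hr s t t' : t <= t' -> h s t <= h s t'.
  move=> tt'; pose u := Num.min s p.1.
  have [us up] : u <= s /\ u <= p.1 by rewrite !ge_min !lexx orbT.
  rewrite -(lg_subr_ge0 hG); apply: (@le_trans _ _ (h u t' - h u t)); last first.
    rewrite -(lg_subr_ge0 hG).
    have := hbox _ _ _ _ us tt'; rewrite /box.
    by rewrite !opprB (AC (2*2) ((1*4)*(3*2)))%AC.
  rewrite lg_subr_ge0// /h !(ltNge p.1) up /= !addr0.
  by apply: f_homo; rewrite // !(ltNge p.1) up.
split=> //.
- move=> s t; apply/andP; split.
    rewrite /h; have [/andP[ps pt]|nst] := boolP (_ && _); last first.
      by rewrite mulr0n addr0 f_ge0.
    rewrite mulr1n; apply: (@le_trans _ _ (mv_grp m + - mv_grp m)).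
      by rewrite subrr.
    by apply: lg_leD2 => //; exact: m_le.
  (* Beyond [p] in both coordinates [f] is at most 0, so [h] is at most [c] there. *)
  apply: (@le_trans _ _ (h (Num.max s (p.1 + 1)) (Num.max t (p.2 + 1)))).
    by apply: (le_trans (hl _ _ _ _) (hr _ _ _ _)); rewrite le_max lexx.
  have [p1 p2] : p.1 < Num.max s (p.1 + 1) /\ p.2 < Num.max t (p.2 + 1).
    by rewrite !lt_max !ltrDl ltr01 !orbT.
  by rewrite /h p1 p2 mulr1n -{2}(add0r c) lg_leD2// f_le0.
- move=> s t y hy; have [ub lub] := sr2_left_continuous hF s t.
  have [/andP[ps pt]|nst] := boolP ((p.1 < s) && (p.2 < t)).
    (* The bound [y] on [h] becomes a bound in [M] with integer part 1; the meet with 0 keeps it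
       inside [M]. *)
    have [a [a1 ag]] := mv_exists1 (lgmeet_ler hG (y - c) 0).
    have : F (s, t) <= a.
      apply: lub => _ [[u v] /= [us vt] <-]; rewrite mv_leE a1 ag -/(n u v) -/(f u v).
      rewrite sr2_intE; have [/andP[pu pv]|//] := boolP (_ && _).
      rewrite ltxx eqxx/=; apply: le_lgmeet => //; last exact: f_le0.
      by rewrite lg_leBrDr//; have := hy _ _ us vt; rewrite /h pu pv.
    rewrite mv_leE a1 -/(n s t) sr2_intE ps pt ltxx eqxx/= ag -/(f s t).
    move=> /le_trans/(_ (lgmeet_lel hG _ _)); rewrite lg_leBrDr//.
    by rewrite /h ps pt.
  have n0 u v : u <= s -> v <= t -> (p.1 < u) && (p.2 < v) = false.
    move=> us vt; apply: contraNF nst => /andP[pu pv].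
    by rewrite (lt_le_trans pu us) (lt_le_trans pv vt).
  have y0 : 0 <= y.
    have [s1 t1] : s - 1 < s /\ t - 1 < t by rewrite !gtrBl.
    apply: le_trans (hy _ _ s1 t1); rewrite /h (n0 _ _ (ltW s1) (ltW t1)) mulr0n addr0.
    by rewrite f_ge0// (n0 _ _ (ltW s1) (ltW t1)).
  have [a [a0 ag]] := mv_exists0 y0.
  have : F (s, t) <= a.
    apply: lub => _ [[u v] /= [us vt] <-]; rewrite mv_leE a0 ag -/(n u v) -/(f u v).
    rewrite sr2_intE (n0 _ _ (ltW us) (ltW vt))/=.
    by have := hy _ _ us vt; rewrite /h (n0 _ _ (ltW us) (ltW vt)) mulr0n addr0.
  rewrite mv_leE a0 -/(n s t) sr2_intE n0//= ag -/(f s t).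
  by rewrite /h n0// mulr0n addr0.
- move=> t y hy; have [_ glb] := sr2_inf_fst hF t.
  (* The join with 0 gives an element of the radical. It is still a lower bound, as [f] is
     nonnegative wherever the integer part is 0. *)
  have [a [a0 ag]] := mv_exists0 (le_lgjoinr hG y 0).
  have : a <= mv0.
    apply: glb => _ [s _ <-]; rewrite mv_leE a0 ag -/(n s t) -/(f s t) sr2_intE.
    have [//|nst] := boolP (_ && _); rewrite /=.
    apply: lgjoin_le; rewrite ?f_ge0//.
    by have := hy s; rewrite /h (negbTE nst) mulr0n addr0.
  rewrite mv_leE a0 ag /=; apply: le_trans.
  exact: le_lgjoinl.
- move=> s y hy; have [_ glb] := sr2_inf_snd hF s.
  have [a [a0 ag]] := mv_exists0 (le_lgjoinr hG y 0).
  have : a <= mv0.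
    apply: glb => _ [t _ <-]; rewrite mv_leE a0 ag -/(n s t) -/(f s t) sr2_intE.
    have [//|nst] := boolP (_ && _); rewrite /=.
    apply: lgjoin_le; rewrite ?f_ge0//.
    by have := hy t; rewrite /h (negbTE nst) mulr0n addr0.
  rewrite mv_leE a0 ag /=; apply: le_trans.
  exact: le_lgjoinl.
- move=> y hy; have [_ lub] := sr2_sup hF.
  have [a [a1 ag]] := mv_exists1 (lgmeet_ler hG (y - c) 0).
  have : mv1 <= a.
    apply: lub => _ [[s t] _ <-]; rewrite mv_leE a1 ag -/(n s t) -/(f s t) sr2_intE.
    have [/andP[ps pt]|//] := boolP (_ && _); rewrite ltxx eqxx/=.
    apply: le_lgmeet => //; last exact: f_le0.
    by rewrite lg_leBrDr//; have := hy s t; rewrite /h ps pt.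
  rewrite mv_leE a1 ag /= => /le_trans/(_ (lgmeet_lel hG _ _)).
  by rewrite lg_leBrDr// add0r.
Qed.

Lemma sr2_observable : exists x : set (R * R) -> perfect_mv G, observable2 x /\
  forall s t, x (quadrant s t) = F (s, t).
Proof.
have [nu [nuT nu0 nuD nuU nuq]] := lattice_stieltjes2 hG hGc sr2_lg_distribution2.
have sB : sigma_algebra setT (@borel2 R) by exact: smallest_sigma_algebra.
pose S : measurableType _ := g_sigma_algebraType [set A : set (R * R) | open A].
have bT : borel2 [set: R * R] by exact: (@measurableT _ S).
have bC A : borel2 A -> borel2 (~` A : set (R * R)) by exact: (@measurableC _ S).
have bU A B : borel2 A -> borel2 B -> borel2 (A `|` B : set (R * R)).
  by move=> bA bB; exact: (@measurableU _ S).
have nu_le A : borel2 A -> nu A <= c.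
  move=> bA; rewrite -nuT -(setvU A) nuD//; [|exact: bC|exact: setICl].
  by apply: lg_lerDl; apply: nu0; exact: bC.
have nu_homo A B : borel2 A -> borel2 B -> A `<=` B -> nu A <= nu B.
  move=> bA bB AB; have bD : borel2 (B `\` A) by exact: (@measurableD _ S).
  by rewrite -(setDUK AB) nuD//; [apply: lg_lerDr; exact: nu0|exact: setDIK].
(* These pairs lie in [M] because [nu A] is between 0 and [c]; non-Borel sets get the dummy value
   [mv0]. *)
have /choice[x xP] (A : set (R * R)) : exists a : perfect_mv G, borel2 A ->
    mv_int a = (`[< A p >])%:R /\ mv_grp a = nu A - c *+ `[< A p >].
  have [bA|nbA] := pselect (borel2 A); last by exists mv0.
  case: asboolP => _.
    have [|a ?] := @mv_exists1 _ (nu A - c); last by exists a.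
    by rewrite lg_subr_le0// nu_le.
  have [|a ?] := @mv_exists0 _ (nu A); first exact: nu0.
  by exists a => _; rewrite mulr0n subr0.
exists x; split; last first.
  move=> s t; have [xi xg] := xP _ (borel2_quadrant s t).
  have pE : `[< quadrant s t p >] = (p.1 < s) && (p.2 < t).
    apply/idP/idP => [/asboolP/quadrantP[-> ->]//|/andP[ps pt]].
    exact/asboolP/quadrantP.
  apply: mv_eqP; first by rewrite xi pE -sr2_intE.
  by rewrite xg pE nuq /h addrK.
split.
- have [xi xg] := xP _ bT; apply: mv_eqP; rewrite ?xi ?xg asboolT//.
  by rewrite nuT mulr1n subrr.
- move=> A B bA bB AB; have [Ai Ag] := xP _ bA; have [Bi Bg] := xP _ bB.
  have [Ui Ug] := xP _ (bU _ _ bA bB).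
  have pU : `[< (A `|` B) p >] = (`[< A p >] + `[< B p >])%N :> nat.
    case: (asboolP (A p)) => Ap; case: (asboolP (B p)) => Bp.
    + by have : (A `&` B) p by []; rewrite AB.
    + by rewrite asboolT//; left.
    + by rewrite asboolT//; right.
    + by rewrite asboolF// => -[].
  rewrite /gpadd; have -> : gval (x A) + gval (x B) = gval (x (A `|` B)).
    apply: zlex_eqP.
      by have : mv_int (x A) + mv_int (x B) = mv_int (x (A `|` B));
        first by rewrite Ai Bi Ui pU natrD.
    have : mv_grp (x A) + mv_grp (x B) = mv_grp (x (A `|` B)) => //.
    by rewrite Ag Bg Ug nuD// pU mulrnDr opprD addrACA.
  exact: valK.
- move=> A bA Ai.
  have bUA : borel2 (\bigcup_i A i) by case: sB => _ _; exact.
  have [ui ug] := xP _ bUA; have [ub lub] := nuU A bA Ai.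
  have Ahomo i j : (i <= j)%N -> A i `<=` A j.
    have ndA : nondecreasing_seq A by apply/nondecreasing_seqP => k; exact/subsetPset.
    by move=> ij; exact/subsetPset/ndA.
  split => [_ [i _ <-]|y yub].
    have [ai ag] := xP _ (bA i); rewrite mv_leE ai ag ui ug.
    have nule : nu (A i) <= nu (\bigcup_i A i) by apply: ub; exists i.
    case: (asboolP (A i p)) => Aip.
      by rewrite asboolT; [rewrite ltxx eqxx/= lg_leD2|exists i].
    by case: asboolP => _; rewrite //= !subr0.
  rewrite mv_leE ui ug; case: asboolP => [[k _ Akp]|nAp].
    (* All [A i] with [i] at least [k] contain [p], so only this tail is compared with [y];
       monotonicity of [nu] takes care of earlier indices. *)
    have yi i : (k <= i)%N -> mv_int y = 1 /\ nu (A i) - c <= mv_grp y.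
      move=> ki; have [ai ag] := xP _ (bA i).
      have : x (A i) <= y by apply: yub; exists i.
      rewrite mv_leE ai ag asboolT; last exact: Ahomo Akp.
      by have [[-> _]|[-> _]] := mvP y; rewrite // ltxx eqxx/=.
    have [-> _] := yi k (leqnn _); rewrite ltxx eqxx/= lg_leBlDr//.
    apply: lub => _ [i _ <-].
    have [_] := yi (maxn k i) (leq_maxl _ _); rewrite lg_leBlDr//; apply: le_trans.
    by apply: nu_homo => //; apply: Ahomo; exact: leq_maxr.
  have [[y0 yg]|[-> //]] := mvP y.
  rewrite y0 ltxx eqxx/= mulr0n subr0; apply: lub => _ [i _ <-].
  have [ai ag] := xP _ (bA i); have : x (A i) <= y by apply: yub; exists i.
  rewrite mv_leE ai ag y0 asboolF ?ltxx ?eqxx/= ?mulr0n ?subr0//.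
  by move=> Aip; apply: nAp; exists i.
Qed.

End SpectralResolution.

(** * Uniqueness of the observable *)

Lemma observable2_setD (R : realType) (G : porderZmodType)
    (x : set (R * R) -> perfect_mv G) (A B : set (R * R)) : observable2 x ->
  borel2 A -> borel2 B -> B `<=` A ->
  gval (x (A `\` B)) = gval (x A) - gval (x B).
Proof.
move=> ox bA bB BA; have bD : borel2 (A `\` B).
  exact: (@measurableD _ (g_sigma_algebraType [set A : set (R * R) | open A])).
have := obs2_add ox bB bD (setDIK B A); rewrite setDUK// /gpadd.
case: insubP => // u _ uE [<-]; rewrite [X in X - _]uE.
by rewrite addrAC subrr add0r.
Qed.

(** The agreement class satisfies [borel2_ind]: differences cancel in the ambient group, and suprema
    in [M] are unique. *)
Lemma observable2_unique (R : realType) (G : porderZmodType)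
    (x y : set (R * R) -> perfect_mv G) : observable2 x -> observable2 y ->
  (forall s t, x (quadrant s t) = y (quadrant s t)) ->
  forall A, borel2 A -> x A = y A.
Proof.
move=> ox oy xy; apply: borel2_ind => [u v|||A bA Ai xyA].
- exact: xy.
- by rewrite (obs2_setT ox) (obs2_setT oy).
- move=> A B bA bB BA xyA xyB; apply: val_inj => /=.
  by rewrite (observable2_setD ox bA bB BA) (observable2_setD oy bA bB BA) xyA xyB.
- apply: (supremums_unique (obs2_sup ox bA Ai)).
  by under eq_fun do rewrite xyA; exact: obs2_sup.
Qed.

Theorem theorem1p5 (R : realType) (G : porderZmodType)
    (hG : is_lgroup G) (hGc : dedekind_sigma_complete G)
    (F : R * R -> perfect_mv G) (hF : spectral_resolution2 F) :
  exists x : set (R * R) -> perfect_mv G,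
    [/\ observable2 x,
        forall s t : R, x (`]-oo, s[ `*` `]-oo, t[) = F (s, t) &
        forall y : set (R * R) -> perfect_mv G, observable2 y ->
          (forall s t : R, y (`]-oo, s[ `*` `]-oo, t[) = F (s, t)) ->
          forall A : set (R * R), borel2 A -> y A = x A].
Proof.
have [p hp [m hm mc]] := sr2_characteristic_point hF.
have [x [ox xq]] := sr2_observable hG hGc hF hp hm mc.
exists x; split => // y oy yq; apply: observable2_unique => // s t.
by rewrite xq; exact: yq.
Qed.
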